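(* (i) Let $B(z)$ be a finite Blaschke product with order $m$ on $\mathbb{D}$ and let $H^2_\beta$ be a weighted Hardy space of polynomial growth. Then the multiplication operator $M_B$ on $H^2_\beta$ is similar to $\bigoplus_1^mM_z$ on $\bigoplus_1^mH^2_\beta$. (ii) This can fail for weighted Hardy spaces of intermediate growth: there exist a weighted Hardy space $H^2_\beta$ of intermediate growth and a finite Blaschke product $B$ of some order $m$ such that $M_B$ on $H^2_\beta$ is not similar to $\bigoplus_1^mM_z$ on $\bigoplus_1^mH^2_\beta$.
   Context: $\mathbb{D}$ is the open unit disk. A finite Blaschke product of order $m\ge1$ is $B(z)=e^{i\theta}\prod_{j=1}^m\frac{z_j-z}{1-\overline{z_j}z}$ with $\theta\in\mathbb{R}$, $z_j\in\mathbb{D}$. $\beta=\{\beta_k\}_{k\ge0}$ is a sequence of positive numbers with $\beta_0=1$, $w_k=\beta_k/\beta_{k-1}$ ($k\ge1$), and it is always assumed that $w_k\to1$. $H^2_\beta=\{f(z)=\sum_{k\ge0}\widehat f(k)z^k:\ \sum_k|\widehat f(k)|^2\beta_k^2<\infty\}$ with $\langle f,g\rangle=\sum_k\beta_k^2\,\widehat f(k)\overline{\widehat g(k)}$. It is of polynomial growth if $\sup_k(k+1)|w_k-1|<\infty$ and of intermediate growth if $\sup_k(k+1)|w_k-1|=\infty$. $M_f$ denotes multiplication by $f$; $M_B$ and $M_z$ are bounded on $H^2_\beta$. Bounded operators $A$ on $\mathcal{H}$ and $C$ on $\mathcal{K}$ are similar ($A\sim C$) if there is a bounded invertible linear operator $X:\mathcal{H}\to\mathcal{K}$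 with $XA=CX$. *)

(* Defs.v *)
From HB Require Import structures.
From mathcomp Require Import all_boot all_order all_algebra complex.
From mathcomp Require Import all_classical all_reals all_analysis.
From mathcomp Require Import ring.

Set Implicit Arguments.
Unset Strict Implicit.
Unset Printing Implicit Defensive.

Import Order.TTheory GRing.Theory Num.Theory.
Import numFieldNormedType.Exports.
Import Normc.

Local Open Scope classical_set_scope.
Local Open Scope complex_scope.
Local Open Scope ring_scope.

(* [R[i]^o] is [R[i]] with the topology and the normed module structure that
   come from its modulus; [normc x : R] is the modulus as a real number,
   whereas [`|x| = (normc x)%:C]. *)

Section Weight.
Variable R : realType.

(* The value [weight_ratio b 0] is irrelevant: the ratios w_k are only used
   for k >= 1. *)
Definition weight_ratio (b : nat -> R) (k : nat) : R := b k / b k.-1.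

Record weight := Weight {
  weight_seq :> nat -> R;
  weight_gt0 : forall k, 0 < weight_seq k;
  weight0 : weight_seq 0%N = 1;
  weight_ratio_cvg1 : weight_ratio weight_seq @ \oo --> (1 : R)
}.

Definition growth_sup (b : weight) : \bar R :=
  ereal_sup [set ((k.+1)%:R * `|weight_ratio b k - 1|)%:E
            | k in [set k : nat | (1 <= k)%N]].

Definition polynomial_growth (b : weight) : Prop := (growth_sup b < +oo)%E.

Definition intermediate_growth (b : weight) : Prop := growth_sup b = +oo%E.

End Weight.

Section H2_carrier.
Variables (R : realType) (b : weight R).
Implicit Types a : nat -> R[i]^o.

Definition h2sum a : \bar R :=
  (\sum_(k <oo) (normc (a k) ^+ 2 * b k ^+ 2)%:E)%E.

Definition h2pred : {pred (nat -> R[i]^o)} := [pred a | h2sum a < +oo]%E.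

Lemma h2term_ge0 a k : 0 <= normc (a k) ^+ 2 * b k ^+ 2.
Proof. by rewrite mulr_ge0 // exprn_even_ge0. Qed.

Lemma h2sum_ge0 a : (0 <= h2sum a)%E.
Proof. by apply: nneseries_ge0 => k _ _; rewrite lee_fin h2term_ge0. Qed.

Lemma h2sumZ (c : R[i]) a : h2sum (c *: a) = ((normc c ^+ 2)%:E * h2sum a)%E.
Proof.
rewrite /h2sum -nneseriesZl; last by move=> k _; rewrite lee_fin h2term_ge0.
apply: eq_eseriesr => k _.
have -> : normc ((c *: a) k) = normc c * normc (a k) by exact: normcM.
by rewrite -EFinM exprMn -mulrA.
Qed.

Lemma h2sum0 : h2sum (0 : nat -> R[i]^o) = 0%E.
Proof. by apply: eseries0 => k _ _; rewrite normc0 expr0n mul0r. Qed.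

Lemma le_h2sumD (s t : R) a a' : 0 < s -> 0 < t ->
  (h2sum (a + a')%R <= ((s + t) / s)%R%:E * h2sum a + ((s + t) / t)%R%:E * h2sum a')%E.
Proof.
move=> s0 t0.
have st0 : 0 < s + t by rewrite addr_gt0.
rewrite /h2sum -!nneseriesZl; try by move=> k _; rewrite lee_fin h2term_ge0.
rewrite -nneseriesD; last 2 first.
- by move=> k _ _; rewrite -EFinM lee_fin mulr_ge0 ?h2term_ge0 ?divr_ge0 ?ltW.
- by move=> k _ _; rewrite -EFinM lee_fin mulr_ge0 ?h2term_ge0 ?divr_ge0 ?ltW.
apply: lee_nneseries => [k _ _|k _]; first by rewrite lee_fin h2term_ge0.
rewrite -!EFinM -EFinD lee_fin [in leRHS]mulrA [X in _ <= _ + X]mulrA -mulrDl ler_wpM2r ?sqr_ge0//.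
set x := normc (a k); set y := normc (a' k).
have x0 : 0 <= x by rewrite /x; case: (a k) => ? ?; exact: sqrtr_ge0.
have y0 : 0 <= y by rewrite /y; case: (a' k) => ? ?; exact: sqrtr_ge0.
have z0 : 0 <= normc ((a + a') k)
  by case: ((a + a') k) => ? ?; exact: sqrtr_ge0.
apply: (@le_trans _ _ ((x + y) ^+ 2)).
  by rewrite ler_sqr ?nnegrE ?addr_ge0//; exact: le_normcD.
rewrite -subr_ge0.
have -> : (s + t) / s * x ^+ 2 + (s + t) / t * y ^+ 2 - (x + y) ^+ 2 =
          (t * x - s * y) ^+ 2 / (s * t).
  by field; rewrite !gt_eqF.
by rewrite divr_ge0 ?sqr_ge0// mulr_ge0 ?ltW.
Qed.

Lemma h2pred_submod_closed : submod_closed h2pred.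
Proof.
split=> [|c x y]; first by rewrite inE /= h2sum0.
rewrite !inE /= => xf yf.
apply: (le_lt_trans (@le_h2sumD 1 1 _ _ ltr01 ltr01)).
rewrite h2sumZ lte_add_pinfty//.
  by rewrite !lte_mul_pinfty ?lee_fin ?sqr_ge0 ?divr_ge0 ?addr_ge0.
by rewrite !lte_mul_pinfty ?lee_fin ?divr_ge0 ?addr_ge0.
Qed.

HB.instance Definition _ := GRing.isSubmodClosed.Build R[i]
  (nat -> R[i]^o) h2pred h2pred_submod_closed.

(* An element of H^2_beta is represented by its sequence of Taylor
   coefficients at 0; [h2eval] below is the function on the disk. *)
Record H2 := MkH2 { h2coef :> nat -> R[i]^o; h2coefP : h2coef \in h2pred }.

HB.instance Definition _ := [isSub for h2coef].
HB.instance Definition _ := [Choice of H2 by <:].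
HB.instance Definition _ := [SubChoice_isSubLmodule of H2 by <:].

End H2_carrier.

Section H2_norm.
Variables (R : realType) (b : weight R).
Implicit Types f g : H2 b.

Definition h2dot f g : R[i]^o :=
  limn (series (fun k => (b k ^+ 2)%:C * f k * (g k)^* : R[i]^o)).

Lemma h2sum_fin_num f : h2sum b f \is a fin_num.
Proof. by rewrite ge0_fin_numE ?h2sum_ge0//; have := h2coefP f; rewrite inE. Qed.

(* The norm of a module over [R[i]] takes its values in [R[i]]. *)
Definition h2norm f : R[i] := (Num.sqrt (fine (h2sum b f)))%:C.

Let sq f : Num.sqrt (fine (h2sum b f)) ^+ 2 = fine (h2sum b f).
Proof. by rewrite sqr_sqrtr// fine_ge0// h2sum_ge0. Qed.

Lemma h2normD f g : h2norm (f + g) <= h2norm f + h2norm g.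
Proof.
rewrite /h2norm -rmorphD lecR.
set x := Num.sqrt (fine (h2sum b f)); set y := Num.sqrt (fine (h2sum b g)).
have x0 : 0 <= x by exact: sqrtr_ge0.
have y0 : 0 <= y by exact: sqrtr_ge0.
apply/ler_addgt0Pr => e e0.
pose s := x + e / 2; pose t := y + e / 2.
have s0 : 0 < s by rewrite ltr_wpDl// divr_gt0.
have t0 : 0 < t by rewrite ltr_wpDl// divr_gt0.
have xs : x <= s by rewrite lerDl ltW// divr_gt0.
have yt : y <= t by rewrite lerDl ltW// divr_gt0.
have -> : x + y + e = s + t by rewrite /s /t addrACA -splitr.
clearbody s t.
have st0 : 0 < s + t by rewrite addr_gt0.
have -> : s + t = Num.sqrt ((s + t) ^+ 2) by rewrite sqrtr_sqr gtr0_norm.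
rewrite ler_wsqrtr// -lee_fin fineK ?h2sum_fin_num//.
apply: (le_trans (le_h2sumD b f g s0 t0)).
rewrite -(fineK (h2sum_fin_num f)) -(fineK (h2sum_fin_num g)).
rewrite -!EFinM -EFinD lee_fin -(sq f) -(sq g) -/x -/y.
have -> : (s + t) ^+ 2 = (s + t) / s * s ^+ 2 + (s + t) / t * t ^+ 2.
  by field; rewrite !gt_eqF.
apply: lerD; apply: ler_wpM2l.
- by rewrite divr_ge0// ltW.
- by rewrite ler_sqr ?nnegrE// ltW.
- by rewrite divr_ge0// ltW.
- by rewrite ler_sqr ?nnegrE// ltW.
Qed.

Lemma h2normZ (c : R[i]) f : h2norm (c *: f) = `|c| * h2norm f.
Proof.
have -> : `|c| = (normc c)%:C by [].
have c0 : 0 <= normc c by case: (c) => ? ?; exact: sqrtr_ge0.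
rewrite /h2norm -rmorphM h2sumZ fineM ?h2sum_fin_num//.
by rewrite sqrtrM ?sqr_ge0// sqrtr_sqr ger0_norm.
Qed.

Lemma h2norm_eq0 f : h2norm f = 0 -> f = 0.
Proof.
move=> /(congr1 (@complex.Re R)) /= /eqP; rewrite sqrtr_eq0 => f0.
apply/val_inj/funext => k /=; apply: eq0_normc.
have bk : b k ^+ 2 != 0 by rewrite expf_neq0// gt_eqF// weight_gt0.
apply/eqP; rewrite -sqrf_eq0; apply/eqP/(mulIf bk); rewrite mul0r.
apply/le_anti; rewrite h2term_ge0 andbT; apply: le_trans f0.
rewrite -lee_fin fineK ?h2sum_fin_num// /h2sum.
rewrite (nneseriesD1 (n := k))//; last by move=> i _; rewrite lee_fin h2term_ge0.
by rewrite leeDl// nneseries_ge0// => i _ _; rewrite lee_fin h2term_ge0.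
Qed.

HB.instance Definition _ := Lmodule_isNormed.Build R[i] (H2 b)
  h2normD h2normZ h2norm_eq0.

Lemma h2norm_dot f : `|f| ^+ 2 = h2dot f f.
Proof.
have -> : `|f| = (Num.sqrt (fine (h2sum b f)))%:C by [].
rewrite -rmorphXn sq /h2dot.
apply/esym/cvg_lim; first exact: norm_hausdorff.
pose u k : R := normc (f k) ^+ 2 * b k ^+ 2.
have ucvg : series u @ \oo --> fine (h2sum b f).
  apply/(@fine_cvg _ _ _ _ (fun n => (series u n)%:E)).
  rewrite fineK ?h2sum_fin_num//.
  under eq_fun do rewrite /series /= -sumEFin.
  by apply: is_cvg_nneseries => k _ _; rewrite lee_fin h2term_ge0.
have -> : series (fun k => (b k ^+ 2)%:C * f k * (f k)^* : R[i]^o) =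
          (fun n => (series u n)%:C : R[i]^o).
  apply/funext => n; rewrite /series /= rmorph_sum; apply: eq_bigr => k _.
  transitivity ((normc (f k))%:C ^+ 2 * (b k ^+ 2)%:C).
    by rewrite -mulrA -sqr_normc mulrC.
  by rewrite /u -(rmorphXn (real_complex R)) -(rmorphM (real_complex R)).
apply/cvgrPdist_lt => -[e e'] /= /andP[/eqP -> e0].
move/cvgrPdist_lt : ucvg => /(_ e e0); apply: filterS => n.
by rewrite -rmorphB normc_def /= expr0n/= addr0 sqrtr_sqr ltcR.
Qed.

End H2_norm.

Section Hilbert_sum.
Variables (K : numClosedFieldType) (m : nat) (V : normedModType K).

Definition hsum : Type := {ffun 'I_m -> V}.

HB.instance Definition _ := GRing.Lmodule.on hsum.

Implicit Types f g : hsum.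

Definition hsum_norm f : K := sqrtC (\sum_i `|f i| ^+ 2).

Lemma hsum_normZ (c : K) f : hsum_norm (c *: f) = `|c| * hsum_norm f.
Proof.
rewrite /hsum_norm; under eq_bigr do rewrite ffunE normrZ exprMn.
rewrite -mulr_sumr sqrtCM ?qualifE/= ?sumr_ge0//.
by rewrite sqrCK.
Qed.

Lemma hsum_norm_eq0 f : hsum_norm f = 0 -> f = 0.
Proof.
move=> /eqP; rewrite sqrtC_eq0 psumr_eq0 => [/allP f0|i _]; last by rewrite exprn_ge0.
apply/ffunP => i; rewrite ffunE; apply/eqP; rewrite -normr_eq0 -sqrf_eq0.
exact: (f0 i (mem_index_enum i)).
Qed.

Lemma hsum_normD f g : hsum_norm (f + g) <= hsum_norm f + hsum_norm g.
Proof.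
have ge0 h : 0 <= hsum_norm h.
  by rewrite sqrtC_ge0 sumr_ge0// => i _; rewrite exprn_ge0.
have := ge0 f; rewrite le_eqVlt => /predU1P[/esym/hsum_norm_eq0 ->|].
  by rewrite add0r lerDr.
have := ge0 g; rewrite le_eqVlt => /predU1P[/esym/hsum_norm_eq0 ->|].
  by rewrite addr0 lerDl.
have Ef : \sum_i `|f i| ^+ 2 = hsum_norm f ^+ 2 by rewrite sqrtCK.
have Eg : \sum_i `|g i| ^+ 2 = hsum_norm g ^+ 2 by rewrite sqrtCK.
move: (hsum_norm f) (hsum_norm g) Ef Eg => A B Ef Eg B0 A0.
have AB0 : 0 < A + B by rewrite addr_gt0.
have S0 : 0 <= \sum_i `|(f + g) i| ^+ 2.
  by apply: sumr_ge0 => i _; rewrite exprn_ge0.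
rewrite /hsum_norm -[A + B]sqrCK ?(ltW AB0)//.
rewrite ler_sqrtC ?nnegrE ?exprn_ge0 ?(ltW AB0)//.
have -> : (A + B) ^+ 2 = (A + B) / A * A ^+ 2 + (A + B) / B * B ^+ 2.
  by field; rewrite !gt_eqF.
rewrite -Ef -Eg !mulr_sumr -big_split /=; apply: ler_sum => i _.
rewrite ffunE; move: (f i) (g i) => x y.
apply: (@le_trans _ _ ((`|x| + `|y|) ^+ 2)).
  by rewrite ler_sqr ?nnegrE ?addr_ge0// ler_normD.
rewrite -subr_ge0.
have -> : (A + B) / A * `|x| ^+ 2 + (A + B) / B * `|y| ^+ 2 -
    (`|x| + `|y|) ^+ 2 = (B * `|x| - A * `|y|) ^+ 2 / (A * B).
  by field; rewrite !gt_eqF.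
apply: divr_ge0; last exact: ltW (mulr_gt0 A0 B0).
by apply: real_exprn_even_ge0; rewrite // realB ?realM ?normr_real ?gtr0_real.
Qed.

HB.instance Definition _ := Lmodule_isNormed.Build K hsum
  hsum_normD hsum_normZ hsum_norm_eq0.

End Hilbert_sum.

Section Hilbert_sum_operator.
Variables (K : numClosedFieldType) (V : normedModType K) (m : nat).
Variable A : {linear V -> V}.

Definition hsum_op (f : hsum m V) : hsum m V := [ffun i => A (f i)].

Lemma hsum_op_is_linear : linear hsum_op.
Proof. by move=> c f g; apply/ffunP => i; rewrite !ffunE linearP. Qed.

HB.instance Definition _ := GRing.isLinear.Build K (hsum m V) (hsum m V)
  *:%R hsum_op hsum_op_is_linear.

End Hilbert_sum_operator.
Arguments hsum_op {K V} m A f.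

Section Operators.
Variable K : numFieldType.

(* For a linear map, boundedness near 0 is boundedness as an operator:
   see [linear_boundedP]. *)
Definition bounded_operator (U V : normedModType K) (A : {linear U -> V}) :=
  bounded_near A (nbhs (0 : U)).

Definition similar_operators (U V : normedModType K)
    (A : {linear U -> U}) (C : {linear V -> V}) : Prop :=
  exists (X : {linear U -> V}) (Y : {linear V -> U}),
    [/\ bounded_operator X, bounded_operator Y, cancel X Y, cancel Y X
      & forall f, X (A f) = C (X f)].

End Operators.

Section Multiplication.
Variable R : realType.

Section on_H2.
Variable b : weight R.

(* As w_k tends to 1, this series converges for every f in H^2_beta and every
   z in the open unit disk; the value is not used elsewhere. *)
Definition h2eval (f : H2 b) (z : R[i]) : R[i]^o :=
  limn (series (fun k => f k * z ^+ k : R[i]^o)).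

(* [M] is the bounded operator M_phi; there is at most one such operator since
   the values on the disk determine an element of H^2_beta. *)
Definition is_multiplication (phi : R[i] -> R[i])
    (M : {linear H2 b -> H2 b}) : Prop :=
  bounded_operator M /\
  forall (f : H2 b) (z : R[i]), `|z| < 1 -> h2eval (M f) z = phi z * h2eval f z.

End on_H2.

Definition finite_blaschke (m : nat) (B : R[i] -> R[i]) : Prop :=
  (1 <= m)%N /\
  exists (theta : R) (a : 'I_m -> R[i]), (forall j, `|a j| < 1) /\
    forall z : R[i], `|z| < 1 ->
      B z = (cos theta +i* sin theta) *
            \prod_j ((a j - z) / (1 - (a j)^* * z)).

End Multiplication.

(* Main.v *)
(* (i) Repeat the zeros of [B] periodically, [a_(i+m) = a_i]. The
   Takenaka-Malmquist functions
     [e_i = s_i / (1 - a_i^* z) \prod_(l < i) (a_l - z) / (1 - a_l^* z)]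
   form an orthonormal basis of the unweighted Hardy space, and multiplication by
   [B] is the shift [w^n e_(n m + j) |-> w^(n+1) e_((n+1) m + j)], with
   [w = exp (i theta)]. Hence the map from [m] copies of the unweighted space
   given by [(f_j)_j |-> \sum_(n, j) f_j(n) w^n e_(n m + j)] is unitary and
   intertwines [m] copies of [M_z] with [M_B]. The coefficients of its matrix are
   geometrically small unless the row and column indices are comparable, because
   the Taylor coefficients of the [e_i] are controlled both on a large circle and
   on a circle of radius less than 1. A weight of polynomial growth is essentially
   constant on the blocks [L^l <= k + 1 < L^(l+1)], so the matrix and its adjoint
   stay bounded for the weighted norms: near the diagonal by unitarity on
   consecutive blocks, away from it as Hilbert-Schmidt matrices. Multiplication by
   [B] on the weighted space is then defined by transport, and it is identified
   through its values on the monomials.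

   (ii) Take [b n = exp (sqrt n)] and [B = z^4]. As [b (n + i) <= b n * b i], the
   n-th power of [M_z] has norm at most [b n], whereas [M_B^n] maps [1] to
   [z^(4 n)], so similarity would give [b (4 n) <= K * b n] for all [n]. *)

Require Import Defs.
From HB Require Import structures.
From mathcomp Require Import all_boot all_order all_algebra complex.
From mathcomp Require Import all_classical all_reals all_analysis.
From mathcomp Require Import ring lra zify.

Set Implicit Arguments.
Unset Strict Implicit.
Unset Printing Implicit Defensive.

Import Order.TTheory GRing.Theory Num.Theory.
Import numFieldNormedType.Exports.
Import Normc.

Local Open Scope classical_set_scope.
Local Open Scope complex_scope.
Local Open Scope ring_scope.

(** * All-pass cells *)

Section Cell.
Variable R : realType.
Local Notation C := R[i].
Implicit Types (a c x y z : C) (f g : nat -> C).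

Lemma normc_ge0 x : 0 <= normc x.
Proof. by case: x => u v; exact: sqrtr_ge0. Qed.

Lemma normcE x : `|x| = (normc x)%:C.
Proof. by []. Qed.

Lemma normc_sqrE x : (normc x ^+ 2)%:C = x * x^*.
Proof. by rewrite rmorphXn -[RHS]normCK. Qed.

Lemma conj_real (r : R) : (r%:C)^* = r%:C :> C.
Proof. by rewrite conj_Creal//; apply/complex_realP; exists r. Qed.

Lemma normc_conj x : normc x^* = normc x.
Proof. by have := norm_conjC x; rewrite !normcE => /complexI. Qed.

Lemma normc_real (r : R) : 0 <= r -> normc r%:C = r.
Proof. by move=> r0; rewrite /= expr0n addr0 sqrtr_sqr ger0_norm. Qed.

Lemma normcX x n : normc (x ^+ n) = normc x ^+ n.
Proof. by elim: n => [|n ih]; rewrite ?expr0 ?normc1// !exprS normcM ih. Qed.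

Lemma normc_sum (I : Type) (r : seq I) (P : pred I) (F : I -> C) :
  normc (\sum_(i <- r | P i) F i) <= \sum_(i <- r | P i) normc (F i).
Proof.
elim/big_ind2 : _ => [|x u y v xu yv|//]; first by rewrite normc0.
by rewrite (le_trans (le_normcD _ _))// lerD.
Qed.

Definition defect a : R := Num.sqrt (1 - normc a ^+ 2).

Lemma defect_sqr a : normc a < 1 -> defect a ^+ 2 = 1 - normc a ^+ 2.
Proof.
by move=> a1; rewrite sqr_sqrtr// subr_ge0 expr_le1 ?normc_ge0// ltW.
Qed.

Lemma defect_sqrC a : normc a < 1 ->
  (defect a)%:C * (defect a)%:C = 1 - a * a^*.
Proof.
by move=> a1; rewrite -normc_sqrE -rmorphM -expr2 defect_sqr// rmorphB rmorph1.
Qed.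

Lemma defect_ge0 a : 0 <= defect a. Proof. exact: sqrtr_ge0. Qed.

Lemma defect_le1 a : defect a <= 1.
Proof. by rewrite -[leRHS]sqrtr1 ler_wsqrtr// gerBl sqr_ge0. Qed.

(* One lossless all-pass section: for the input [f] the state is
   [s z / (1 - a^* z) f] and the output [(a - z) / (1 - a^* z) f], where
   [s ^+ 2 = 1 - |a| ^+ 2]. *)
Fixpoint state a f (k : nat) : C :=
  if k is l.+1 then a^* * state a f l + (defect a)%:C * f l else 0.

Definition output a f (k : nat) : C := a * f k - (defect a)%:C * state a f k.

(** The matrix [[[a^*, s], [- s, a]]] sending (state, input) to (next state, output) is unitary
    because [s ^+ 2 = 1 - |a| ^+ 2]; this is its polarized form, with independent times [k] and
    [l]. *)
Lemma cell_unitary a f g k l : normc a < 1 ->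
  state a f k.+1 * (state a g l.+1)^* + output a f k * (output a g l)^* =
  state a f k * (state a g l)^* + f k * (g l)^*.
Proof.
move=> /defect_sqrC; rewrite /output /=.
move: (state a f k) (state a g l) (defect a) => u v s sE.
rewrite !(rmorphD, rmorphN, rmorphM) /= !conj_real conjCK.
move: (s%:C) (u) (v^*) (g l)^* (a^*) sE => {}s p q r b sE.
by ring: sE.
Qed.

(** Sum of [cell_unitary] over equal times, from the zero initial state: what the output has not yet
    returned is stored in the state at time [n]. *)
Lemma output_conservation a f g n : normc a < 1 ->
  \sum_(k < n) output a f k * (output a g k)^* +
    state a f n * (state a g n)^* =
  \sum_(k < n) f k * (g k)^*.
Proof.
move=> a1; elim: n => [|n ih]; first by rewrite !big_ord0 /= mul0r addr0.
rewrite !big_ord_recr /= -ih -!addrA; congr (_ + _).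
by rewrite [LHS]addrC cell_unitary.
Qed.

Lemma output_rec a f k : normc a < 1 ->
  output a f k.+1 = a^* * output a f k + a * f k.+1 - f k.
Proof.
move=> /defect_sqrC; rewrite /output /=.
move: (state a f k) ((defect a)%:C) (a^*) => u s b sE.
by ring: sE.
Qed.

Definition delay f (k : nat) : C := if k is l.+1 then f l else 0.

(** Multiplication of the formal power series of [f] by [u - v z]. It serves to check identities of
    rational functions after clearing denominators. *)
Definition delay_comb (u v : C) f (k : nat) : C := u * f k - v * delay f k.

Lemma delay_combC u v p q f :
  delay_comb u v (delay_comb p q f) = delay_comb p q (delay_comb u v f).
Proof. by apply/funext => -[|[|k]]; rewrite /delay_comb /=; ring. Qed.

Lemma delay_comb_inj c : injective (delay_comb 1 c).
Proof.
move=> f g H; apply/funext; elim=> [|k ih].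
  by have := congr1 (@^~ 0%N) H; rewrite /delay_comb /= !mulr0 !subr0 !mul1r.
by have := congr1 (@^~ k.+1) H; rewrite /delay_comb /= ih !mul1r => /addIr.
Qed.

(** This identifies [output a] as multiplication by [(a - z) / (1 - a^* z)] without dividing. *)
Lemma delay_comb_output a f : normc a < 1 ->
  delay_comb 1 a^* (output a f) = delay_comb a 1 f.
Proof.
move=> a1; apply/funext => -[|k]; rewrite /delay_comb /=.
  by rewrite /output /=; ring.
by rewrite output_rec//; ring.
Qed.

Lemma delay_comb_state a f :
  delay_comb 1 a^* (fun k => state a f k.+1) = delay_comb (defect a)%:C 0 f.
Proof. by apply/funext => -[|k]; rewrite /delay_comb /=; ring. Qed.

(** Both sides agree after multiplication by [1 - a^* z] and [1 - c^* z], which is injective on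
    power series. *)
Lemma outputC a c f : normc a < 1 -> normc c < 1 ->
  output a (output c f) = output c (output a f).
Proof.
move=> a1 c1; apply: (@delay_comb_inj a^*); apply: (@delay_comb_inj c^*).
rewrite delay_comb_output// delay_combC delay_comb_output//.
rewrite [in RHS]delay_combC [in RHS]delay_comb_output// [in RHS]delay_combC.
by rewrite [in RHS]delay_comb_output// delay_combC.
Qed.

Lemma state_outputC a c f : normc a < 1 -> normc c < 1 ->
  (fun k => state a (output c f) k.+1) = output c (fun k => state a f k.+1).
Proof.
move=> a1 c1; apply: (@delay_comb_inj a^*); apply: (@delay_comb_inj c^*).
rewrite delay_comb_state delay_combC delay_comb_output//.
rewrite [in RHS]delay_combC [in RHS]delay_comb_output// [in RHS]delay_combC.
by rewrite [in RHS]delay_comb_state delay_combC.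
Qed.

(** The sequence [u k = M * x ^+ k / (x - normc a)] solves [u k.+1 = normc a * u k + M * x ^+ k]
    exactly, so it dominates the state by induction. *)
Lemma state_bound a f (M x : R) : normc a < x -> 0 <= M ->
  (forall k, normc (f k) <= M * x ^+ k) ->
  forall k, normc (state a f k) <= M * x ^+ k / (x - normc a).
Proof.
move=> ax M0 fM; have x0 : 0 < x by rewrite (le_lt_trans (normc_ge0 a)).
have xa : 0 < x - normc a by rewrite subr_gt0.
elim=> [|k ih].
  rewrite (_ : state a f 0 = 0)// normc0 divr_ge0 ?(ltW xa)//.
  by rewrite mulr_ge0// exprn_ge0 ?ltW.
rewrite [state _ _ _]/= (le_trans (le_normcD _ _))// !normcM normc_conj normc_real ?defect_ge0//.
rewrite (@le_trans _ _ (normc a * (M * x ^+ k / (x - normc a)) + 1 * (M * x ^+ k)))//.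
  apply: lerD; first by rewrite ler_wpM2l// normc_ge0.
  by rewrite ler_pM ?defect_ge0 ?normc_ge0 ?defect_le1.
by rewrite exprS le_eqVlt; apply/orP; left; apply/eqP; field; rewrite gt_eqF.
Qed.

(** Each cell costs a factor [r] at a fixed rate [x]. If [x < 1] then [r] exceeds 1, but when
    [normc a < 1] a large [x] allows [r < 1]; both regimes are used. *)
Lemma output_bound a f (M x r : R) : normc a < x -> 0 <= M ->
  normc a + (x - normc a)^-1 <= r ->
  (forall k, normc (f k) <= M * x ^+ k) ->
  forall k, normc (output a f k) <= M * r * x ^+ k.
Proof.
move=> ax M0 rE fM k; have x0 : 0 < x by rewrite (le_lt_trans (normc_ge0 a)).
have xa : 0 < x - normc a by rewrite subr_gt0.
rewrite (le_trans (le_normcD _ _))// normcN !normcM normc_real ?defect_ge0//.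
apply: (@le_trans _ _ ((normc a + (x - normc a)^-1) * (M * x ^+ k))); last first.
  by rewrite [M * r]mulrC -mulrA ler_wpM2r// mulr_ge0// exprn_ge0// ltW.
rewrite mulrDl; apply: lerD; first by rewrite ler_wpM2l ?normc_ge0.
rewrite [leRHS]mulrC -[leRHS]mul1r ler_pM ?defect_ge0 ?normc_ge0 ?defect_le1//.
exact: state_bound.
Qed.

End Cell.

(** * The Takenaka-Malmquist system *)

Section Contraction.
Variable R : realType.
Local Notation C := R[i].
Implicit Types V : nat -> nat -> C.

Lemma normc_sqr_sumE n (F : nat -> C) :
  (normc (\sum_(k < n) F k) ^+ 2)%:C = \sum_(k < n) \sum_(l < n) F k * (F l)^*.
Proof.
rewrite normc_sqrE rmorph_sum /= mulr_suml; apply: eq_bigr => k _.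
by rewrite mulr_sumr.
Qed.

Definition contraction V := forall m n (x : nat -> C),
  \sum_(k < m) normc (\sum_(i < n) V k i * x i) ^+ 2 <=
  \sum_(i < n) normc (x i) ^+ 2.

(* From [|y - V V^* y|^2 >= 0] and [|V V^* y| <= |V^* y|]. *)
Lemma contraction_adjoint V : contraction V ->
  contraction (fun i k => (V k i)^*).
Proof.
move=> Vc n m y.
pose x i := \sum_(k < m) (V k i)^* * y k.
pose z k := \sum_(i < n) V k i * x i.
have zx : \sum_(k < m) normc (z k) ^+ 2 <= \sum_(i < n) normc (x i) ^+ 2 := Vc m n x.
change (\sum_(i < n) normc (x i) ^+ 2 <= \sum_(k < m) normc (y k) ^+ 2).
set S := (X in _ <= X) in zx *.
have zE : \sum_(k < m) y k * (z k)^* = S%:C.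
  rewrite /S rmorph_sum /=.
  transitivity (\sum_(k < m) \sum_(i < n) (V k i)^* * y k * (x i)^*).
    apply: eq_bigr => k _; rewrite /z rmorph_sum /= mulr_sumr; apply: eq_bigr => i _.
    by rewrite rmorphM /=; ring.
  rewrite exchange_big /=. apply: eq_bigr => i _.
  by rewrite normc_sqrE {2}/x mulr_suml.
have zE' : \sum_(k < m) z k * (y k)^* = S%:C.
  rewrite -[RHS]conj_real -zE rmorph_sum /=; apply: eq_bigr => k _.
  by rewrite rmorphM /= conjCK mulrC.
have : 0 <= \sum_(k < m) normc (y k - z k) ^+ 2 by apply: sumr_ge0 => k _; exact: sqr_ge0.
have -> : \sum_(k < m) normc (y k - z k) ^+ 2 =
    \sum_(k < m) normc (y k) ^+ 2 + \sum_(k < m) normc (z k) ^+ 2 - S - S.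
  apply: complexI; rewrite !(rmorphB, rmorphD) /= -{1}zE -zE' !rmorph_sum /=.
  rewrite -big_split -!sumrB /=; apply: eq_bigr => k _.
  by rewrite !normc_sqrE rmorphB /=; ring.
by move=> yz; rewrite -/S; lra.
Qed.

End Contraction.

Section Takenaka_Malmquist.
Variable R : realType.
Local Notation C := R[i].
Implicit Types a : nat -> C.

(** Taylor coefficients of the partial Blaschke product [\prod_(l < i) (a_l - z) / (1 - a_l^* z)],
    obtained by feeding the unit impulse to a cascade of cells. *)
Fixpoint allpass a i : nat -> C :=
  if i is j.+1 then output (a j) (allpass a j) else fun k => (k == 0%N)%:R.

(* Taylor coefficients of the i-th Takenaka-Malmquist function
   [s_i / (1 - a_i^* z) \prod_(l < i) (a_l - z) / (1 - a_l^* z)]. *)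
Definition tm a i (k : nat) : C := state (a i) (allpass a i) k.+1.

Variable (al : R).
Hypothesis al1 : al < 1.
Definition zeros_le a := forall i, normc (a i) <= al.

Lemma zeros_lt1 a i : zeros_le a -> normc (a i) < 1.
Proof. by move=> ha; rewrite (le_lt_trans (ha i)). Qed.

(** The cells commute, so the first one can be moved to the end of the cascade. This prepares
    inductions that replace [a] by [a \o S]. *)
Lemma allpass_shift a i : zeros_le a ->
  allpass a i.+1 = output (a 0%N) (allpass (a \o S) i).
Proof.
move=> ha; elim: i => [//|i ih].
by rewrite [LHS]/= -[output (a i) _]/(allpass a i.+1) ih outputC//; exact: zeros_lt1.
Qed.

Lemma tm_shift a i : zeros_le a ->
  tm a i.+1 = output (a 0%N) (tm (a \o S) i).
Proof.
by move=> ha; rewrite /tm allpass_shift// state_outputC//; exact: zeros_lt1.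
Qed.

(** Unitarity summed over the first [N] cells: the output of each cell is the input of the next, and
    the last term comes from the impulse. *)
Lemma tm_gram_rec a N k l : zeros_le a ->
  \sum_(i < N) tm a i k * (tm a i l)^* + allpass a N k * (allpass a N l)^* =
  \sum_(i < N) state (a i) (allpass a i) k * (state (a i) (allpass a i) l)^* +
    (k == 0%N)%:R * (l == 0%N)%:R.
Proof.
move=> ha; elim: N => [|N ih].
  by rewrite !big_ord0 /= conjC_nat.
rewrite !big_ord_recr /= -addrA.
have -> : tm a N k * (tm a N l)^* + allpass a N.+1 k * (allpass a N.+1 l)^* =
  state (a N) (allpass a N) k * (state (a N) (allpass a N) l)^* +
  allpass a N k * (allpass a N l)^*.
  by apply: cell_unitary; exact: zeros_lt1.
by rewrite addrCA ih addrCA addrA addrAC.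
Qed.

(** The coefficient of [z^k] in [z^t] times the N-th all-pass product. *)
Let lagged a N (k t : nat) : C := if (t <= k)%N then allpass a N (k - t) else 0.

(* The Christoffel-Darboux formula: unitarity of the cells, telescoped along
   the diagonals. *)
Lemma tm_gram a N n k l : zeros_le a -> (k < n)%N -> (l < n)%N ->
  \sum_(i < N) tm a i k * (tm a i l)^* =
  (k == l)%:R - \sum_(t < n) lagged a N k t * (lagged a N l t)^*.
Proof.
move=> ha; elim: n k l => [//|n ih] k l kn ln.
rewrite big_ord_recl /= {1 2}/lagged /= !subn0.
have := tm_gram_rec N k l ha; move/eqP; rewrite -subr_eq => /eqP E.
case: k kn E => [|k] kn E.
  rewrite [X in _ - (_ + X)]big1 => [|t _]; last by rewrite /lagged /= mul0r.
  rewrite -[LHS](addrK (allpass a N 0 * (allpass a N l)^*)) tm_gram_rec//.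
  rewrite big1 => [|i _]; last by rewrite /= mul0r.
  by rewrite add0r addr0 eqxx mul1r eq_sym.
case: l ln E => [|l] ln E.
  rewrite [X in _ - (_ + X)]big1 => [|t _]; last by rewrite /lagged /= conjC0 mulr0.
  rewrite -[LHS](addrK (allpass a N k.+1 * (allpass a N 0)^*)) tm_gram_rec//.
  rewrite big1 => [|i _]; last by rewrite /= conjC0 mulr0.
  by rewrite add0r addr0 mul0r.
rewrite -[LHS](addrK (allpass a N k.+1 * (allpass a N l.+1)^*)) tm_gram_rec//.
have -> : \sum_(i < N) state (a i) (allpass a i) k.+1 * (state (a i) (allpass a i) l.+1)^* =
  \sum_(i < N) tm a i k * (tm a i l)^* by [].
by rewrite ih// mul0r addr0 eqSS opprD addrA addrAC.
Qed.

Lemma tm_contraction a : zeros_le a -> contraction (fun k i => tm a i k).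
Proof.
(* It is enough to treat the adjoint, for which [tm_gram] exhibits the missing part of the norm as a
   sum of squares. *)
move=> ha; suff H : contraction (fun i k => (tm a i k)^*).
  move=> m n x; have := contraction_adjoint H m n x.
  by under eq_bigr do under eq_bigr do rewrite conjCK.
move=> N n y; pose p t k := lagged a N k t.
have -> : \sum_(k < n) normc (y k) ^+ 2 =
  \sum_(i < N) normc (\sum_(k < n) (tm a i k)^* * y k) ^+ 2 +
  \sum_(t < n) normc (\sum_(k < n) (p t k)^* * y k) ^+ 2.
  apply: complexI; rewrite rmorphD !rmorph_sum /=.
  under [X in _ = X + _]eq_bigr => i _ do
    rewrite (normc_sqr_sumE n (fun k => (tm a i k)^* * y k)).
  under [X in _ = _ + X]eq_bigr => t _ do
    rewrite (normc_sqr_sumE n (fun k => (p t k)^* * y k)).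
  rewrite exchange_big [X in _ = _ + X]exchange_big -big_split /=; apply: eq_bigr => k _.
  rewrite exchange_big [X in _ = _ + X]exchange_big -big_split /=.
  transitivity (\sum_(l < n) y k * (y l)^* * (l == k :> nat)%:R).
    rewrite normc_sqrE (bigD1 k)//= eqxx mulr1 big1 ?addr0// => l /negbTE.
    by rewrite -val_eqE /= => ->; rewrite mulr0.
  apply: eq_bigr => l _; rewrite -[_%:R](subrK (\sum_(t < n) lagged a N l t * (lagged a N k t)^*)).
  rewrite -(tm_gram N ha (ltn_ord l) (ltn_ord k)) mulrDr !mulr_sumr.
  by congr (_ + _); apply: eq_bigr => i _; rewrite rmorphM /= conjCK /p; ring.
by rewrite lerDl sumr_ge0// => t _; exact: sqr_ge0.
Qed.

Lemma allpass_bound a (x r : R) : zeros_le a -> al < x -> al + (x - al)^-1 <= r ->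
  forall i k, normc (allpass a i k) <= r ^+ i * x ^+ k.
Proof.
move=> ha ax axr; have al0 : 0 <= al by rewrite (le_trans _ (ha 0%N)) ?normc_ge0.
have x0 : 0 < x by rewrite (le_lt_trans al0).
have xa0 : 0 < x - al by rewrite subr_gt0.
have r0 : 0 <= r by rewrite (le_trans _ axr)// addr_ge0// invr_ge0 ltW.
elim=> [|i ih] k.
  rewrite expr0 mul1r /=; case: k => [|k]; first by rewrite normc1 expr0.
  by rewrite normc0 exprn_ge0// ltW.
rewrite exprSr; apply: output_bound => //.
- exact: le_lt_trans ax.
- by rewrite exprn_ge0.
- apply: le_trans axr; apply: lerD => //; rewrite lef_pV2 ?posrE ?lerB//.
  by rewrite subr_gt0 (le_lt_trans (ha _)).
Qed.

Lemma tm_bound a (x r : R) : zeros_le a -> al < x -> al + (x - al)^-1 <= r ->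
  forall i k, normc (tm a i k) <= x * r * (r ^+ i * x ^+ k).
Proof.
move=> ha ax axr i k; have al0 : 0 <= al by rewrite (le_trans _ (ha 0%N)) ?normc_ge0.
have x0 : 0 < x by rewrite (le_lt_trans al0).
have xa0 : 0 < x - al by rewrite subr_gt0.
have xr : (x - al)^-1 <= r by rewrite (le_trans _ axr)// lerDr.
have r0 : 0 <= r by rewrite (le_trans _ xr)// invr_ge0 ltW.
have := @state_bound R (a i) (allpass a i) (r ^+ i) x.
move=> /(_ (le_lt_trans (ha i) ax) (exprn_ge0 _ r0) (allpass_bound ha ax axr i) k.+1) /le_trans; apply.
rewrite (@le_trans _ _ (r ^+ i * x ^+ k.+1 * r))//.
  rewrite ler_wpM2l ?mulr_ge0 ?exprn_ge0 ?(ltW x0)//; apply: le_trans xr.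
  by rewrite lef_pV2 ?posrE ?lerB// subr_gt0 (le_lt_trans (ha _)).
by rewrite exprS le_eqVlt; apply/orP; left; apply/eqP; ring.
Qed.

(** The two rates are exchanged by [x |-> al + (x - al)^-1]: the rate [x = q] costs [Q] per cell,
    and [x = Q] costs [q] per cell. *)
Let q := (1 + al) / 2.
Let Q := al + 2 / (1 - al).

Lemma allpass_decay a i k : zeros_le a ->
  normc (allpass a i k) <= q ^+ i * Q ^+ k.
Proof.
move=> ha; have a1 : 0 < 1 - al by rewrite subr_gt0.
apply: allpass_bound => //; first by rewrite ltrDl divr_gt0.
by rewrite /q /Q le_eqVlt; apply/orP; left; apply/eqP; field; lra.
Qed.

Lemma tm_decay1 a i k : zeros_le a ->
  normc (tm a i k) <= Q * q * (q ^+ i * Q ^+ k).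
Proof.
move=> ha; have a1 : 0 < 1 - al by rewrite subr_gt0.
apply: tm_bound => //; first by rewrite ltrDl divr_gt0.
by rewrite /q /Q le_eqVlt; apply/orP; left; apply/eqP; field; lra.
Qed.

Lemma tm_decay2 a i k : zeros_le a ->
  normc (tm a i k) <= q * Q * (Q ^+ i * q ^+ k).
Proof.
move=> ha; have a1 : 0 < 1 - al by rewrite subr_gt0.
apply: tm_bound => //; first by rewrite /q; lra.
by rewrite /q /Q le_eqVlt; apply/orP; left; apply/eqP; field; lra.
Qed.

End Takenaka_Malmquist.

(** * Orthonormality and completeness with geometric rates *)

Section Orthonormality.
Variables (R : realType) (al : R).
Local Notation C := R[i].
Hypothesis al1 : al < 1.
Implicit Types a : nat -> C.
Let q := (1 + al) / 2.
Let Q := al + 2 / (1 - al).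

(** By [tm_gram] the error is a sum over lags [t <= k + l] of products of coefficients of the N-th
    all-pass product, which are geometrically small in [N] by [allpass_decay]. *)
Lemma tm_complete a k l : zeros_le al a -> exists A : R, forall N,
  normc (\sum_(i < N) tm a i k * (tm a i l)^* - (k == l)%:R) <= A * q ^+ N.
Proof.
move=> ha; have al0 : 0 <= al by rewrite (le_trans _ (ha 0%N)) ?normc_ge0.
have q0 : 0 <= q by move: al1; rewrite /q; lra.
have q1 : q <= 1 by move: al1; rewrite /q; lra.
have Q0 : 0 <= Q by rewrite addr_ge0// divr_ge0// subr_ge0 ltW.
exists (\sum_(t < (k + l).+1) Q ^+ (k - t) * Q ^+ (l - t)) => N.
rewrite (tm_gram al1 N ha (n := (k + l).+1)) ?ltnS ?leq_addr ?leq_addl//.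
rewrite addrC addKr normcN (le_trans (normc_sum _ _ _))// mulr_suml.
apply: ler_sum => t _; rewrite normcM normc_conj.
have B j : normc (if (t <= j)%N then allpass a N (j - t) else 0) <= q ^+ N * Q ^+ (j - t).
  case: ifP => _; first exact: allpass_decay.
  by rewrite normc0 mulr_ge0// exprn_ge0.
apply: le_trans (ler_pM (normc_ge0 _) (normc_ge0 _) (B k) (B l)) _.
rewrite mulrACA [leRHS]mulrC ler_wpM2r ?mulr_ge0 ?exprn_ge0//.
by rewrite -[leRHS]mulr1 ler_wpM2l ?exprn_ge0// exprn_ile1.
Qed.

Lemma tm0E a k : tm a 0 k = (defect (a 0%N))%:C * (a 0%N)^* ^+ k.
Proof.
rewrite /tm; elim: k => [|k ih]; first by rewrite /= mulr0 add0r expr0.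
by rewrite [LHS]/= -[X in _ * X + _]/(state _ _ k.+1) ih /= mulr0 addr0 exprS; ring.
Qed.

Lemma tm0_norm a n : zeros_le al a ->
  \sum_(k < n) tm a 0 k * (tm a 0 k)^* = 1 - (a 0%N * (a 0%N)^*) ^+ n.
Proof.
move=> ha; elim: n => [|n ih]; first by rewrite big_ord0 expr0 subrr.
rewrite big_ord_recr /= ih tm0E rmorphM rmorphXn /= conj_real conjCK.
rewrite mulrACA defect_sqrC ?(zeros_lt1 al1)// exprMn_comm; last exact: mulrC.
by rewrite exprS exprMn; ring.
Qed.

(** [tm a 0] is the normalized reproducing kernel at [a_0], where the all-pass factor vanishes;
    truncating the pairing leaves only a boundary term. *)
Lemma tm0_output a f n : zeros_le al a ->
  \sum_(k < n) output (a 0%N) f k * (tm a 0 k)^* =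
  state (a 0%N) f n * a 0%N ^+ n.
Proof.
move=> ha; elim: n => [|n ih]; first by rewrite big_ord0 mul0r.
rewrite big_ord_recr /= ih tm0E rmorphM rmorphXn /= conj_real conjCK /output.
have := defect_sqrC (zeros_lt1 al1 0 ha).
move: ((defect (a 0%N))%:C) (a 0%N) (state _ _ _) => s c u sE.
by rewrite exprS; ring: sE.
Qed.

Lemma tm_state_decay a i (c : C) : zeros_le al a -> normc c <= al ->
  exists2 A : R, 0 <= A & forall n, normc (state c (tm a i) n) <= A * q ^+ n.
Proof.
move=> ha hc; have al0 : 0 <= al by rewrite (le_trans _ (ha 0%N)) ?normc_ge0.
have qa : normc c < q by rewrite (le_lt_trans hc)//; move: al1; rewrite /q; lra.
have q0 : 0 <= q by move: al1; rewrite /q; lra.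
have Q0 : 0 <= Q by rewrite addr_ge0// divr_ge0// subr_ge0 ltW.
have M0 : 0 <= q * Q * Q ^+ i by rewrite mulr_ge0 ?exprn_ge0// mulr_ge0.
exists (q * Q * Q ^+ i / (q - normc c)) => [|n].
  by rewrite divr_ge0// subr_ge0 ltW.
rewrite mulrAC; apply: state_bound => // k.
by rewrite -mulrA; exact: tm_decay2.
Qed.

Lemma tm_orthogonal0 a m : zeros_le al a -> exists A : R, forall n,
  normc (\sum_(k < n) tm a m.+1 k * (tm a 0 k)^*) <= A * q ^+ n.
Proof.
move=> ha; have ha' : zeros_le al (a \o S) by move=> ?; exact: ha.
have [A A0 HA] := tm_state_decay m ha' (ha 0%N); exists A => n.
rewrite (tm_shift al1)// tm0_output// normcM normcX.
apply: le_trans (ler_pM (normc_ge0 _) _ (HA n) (_ : _ <= 1)) _.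
- by rewrite exprn_ge0// normc_ge0.
- by rewrite exprn_ile1 ?normc_ge0// ltW// (zeros_lt1 al1).
- by rewrite mulr1.
Qed.

(** Induction on [i]. When both indices are positive, [tm_shift] writes both functions as outputs of
    the first cell, which preserves pairings up to a geometrically small product of states. *)
Lemma tm_orthonormal a i j : zeros_le al a -> exists A : R, forall n,
  normc (\sum_(k < n) tm a i k * (tm a j k)^* - (i == j)%:R) <= A * q ^+ n.
Proof.
elim: i a j => [|i ih] a j ha;
  have al0 : 0 <= al by rewrite (le_trans _ (ha 0%N)) ?normc_ge0.
all: have q0 : 0 <= q by move: al1; rewrite /q; lra.
all: have q1 : q <= 1 by move: al1; rewrite /q; lra.
all: have aq : normc (a 0%N) <= q by rewrite (le_trans (ha _))//; move: al1; rewrite /q; lra.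
- case: j => [|j].
    exists 1 => n; rewrite tm0_norm// addrAC subrr sub0r normcN normcX ?normcM.
    have aq2 : normc (a 0%N) * normc (a 0%N)^* <= q.
      rewrite normc_conj (le_trans _ aq)// ler_piMr ?normc_ge0//.
      by rewrite (le_trans aq).
    by rewrite mul1r lerXn2r// nnegrE mulr_ge0// normc_ge0.
  have [A HA] := tm_orthogonal0 j ha; exists A => n; apply: le_trans (HA n).
  rewrite subr0 -normc_conj rmorph_sum /=.
  by under eq_bigr do rewrite rmorphM /= conjCK mulrC.
- case: j => [|j].
    by have [A HA] := tm_orthogonal0 i ha; exists A => n; rewrite subr0.
  have ha' : zeros_le al (a \o S) by move=> ?; exact: ha.
  have [A HA] := ih _ j ha'.
  have [A1 A10 HA1] := tm_state_decay i ha' (ha 0%N).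
  have [A2 A20 HA2] := tm_state_decay j ha' (ha 0%N).
  exists (A + A1 * A2) => n; rewrite !(tm_shift al1)//.
  have := output_conservation (tm (a \o S) i) (tm (a \o S) j) n (zeros_lt1 al1 0 ha).
  move/esym/eqP; rewrite -subr_eq => /eqP <-.
  rewrite eqSS addrAC (le_trans (le_normcD _ _))// normcN normcM normc_conj mulrDl.
  apply: lerD; first exact: HA.
  apply: le_trans (ler_pM (normc_ge0 _) (normc_ge0 _) (HA1 n) (HA2 n)) _.
  rewrite mulrACA ler_wpM2l ?mulr_ge0// -[leRHS]mulr1 ler_wpM2l ?exprn_ge0//.
  by rewrite exprn_ile1.
Qed.

End Orthonormality.

(** * Weights and weighted matrices *)

Section Weighted_matrices.
Variable R : realType.
Local Notation C := R[i].
Implicit Types (V : nat -> nat -> C) (x : nat -> C).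

(** Cauchy-Schwarz, from the Lagrange identity: twice the difference is the sum of the squares
    [(u i * v j - u j * v i) ^+ 2]. *)
Lemma sum_mul_sqr_le n (u v : nat -> R) :
  (\sum_(i < n) u i * v i) ^+ 2 <=
  (\sum_(i < n) u i ^+ 2) * (\sum_(i < n) v i ^+ 2).
Proof.
rewrite expr2 !mulr_suml.
under eq_bigr do rewrite mulr_sumr.
under [leRHS]eq_bigr do rewrite mulr_sumr.
set A := (X in X <= _); set B := (X in _ <= X).
suff : 0 <= B + B - A - A by lra.
have {1}-> : B = \sum_(i < n) \sum_(j < n) u j ^+ 2 * v i ^+ 2 by rewrite /B exchange_big.
rewrite /A /B -big_split -!sumrB sumr_ge0// => i _.
rewrite -big_split -!sumrB sumr_ge0// => j _ /=.
by rewrite (_ : _ - _ = (u i * v j - u j * v i) ^+ 2) ?sqr_ge0//; ring.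
Qed.

Lemma sum_geometric_le n (t : R) : 0 <= t < 1 ->
  \sum_(i < n) t ^+ i <= (1 - t)^-1.
Proof.
move=> /andP[t0 t1]; have t10 : 0 < 1 - t by rewrite subr_gt0.
rewrite -[leRHS]mul1r ler_pdivlMr//.
have -> : (\sum_(i < n) t ^+ i) * (1 - t) = 1 - t ^+ n.
  by rewrite -[RHS]opprB subrX1 -mulNr opprB mulrC.
by rewrite gerBl exprn_ge0.
Qed.

Lemma growth_bound (u : nat -> R) (N : nat) (s : R) : 0 < s ->
  (forall k, 0 < u k) -> (forall k, (N <= k)%N -> u k.+1 <= s * u k) ->
  exists2 A : R, 0 < A & forall k, u k <= A * s ^+ k.
Proof.
(* The sum dominates each of its terms, so [A * s ^+ k] already bounds [u k] for [k <= N]; the ratio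
   bound takes over from there. *)
move=> s0 u0 us; pose A := \sum_(j < N.+1) u j / s ^+ j.
have H k : (k <= N)%N -> u k <= A * s ^+ k.
  move=> kN; rewrite -ler_pdivrMr ?exprn_gt0// /A (bigD1 (Ordinal (kN : (k < N.+1)%N)))//=.
  by rewrite lerDl sumr_ge0// => j _; rewrite divr_ge0 ?exprn_ge0 ?ltW.
exists A => [|k].
  have := H 0%N (leq0n _); rewrite expr0 mulr1; exact: lt_le_trans.
have [/H//|Nk] := leqP k N.
elim: k Nk => [//|k ih]; rewrite ltnS leq_eqVlt => /orP[/eqP kN|Nk].
  by rewrite (le_trans (us _ _)) ?kN// exprS mulrCA ler_wpM2l ?(ltW s0)// H// kN.
by rewrite (le_trans (us _ (ltnW Nk)))// exprS mulrCA ler_wpM2l ?(ltW s0)// ih.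
Qed.

Lemma weight_near1 (b : weight R) (s : R) : 1 < s ->
  exists N, forall k, (N <= k)%N -> b k.+1 <= s * b k /\ b k <= s * b k.+1.
Proof.
move=> s1; have s0 : 0 < s by rewrite (lt_trans _ s1).
have e0 : 0 < Num.min (s - 1) (1 - s^-1).
  by rewrite lt_min !subr_gt0 s1 invf_lt1.
have /cvgrPdist_lt /(_ _ e0)[N _ HN] := weight_ratio_cvg1 b.
exists N => k Nk; have := HN k.+1 (leqW Nk).
rewrite /weight_ratio /= lt_min !ltr_norml => /andP[/andP[h1 _] /andP[_ h2]].
have bk := weight_gt0 b k; have bk1 := weight_gt0 b k.+1.
split.
  by rewrite -ler_pdivrMr// ltW//; lra.
rewrite mulrC -ler_pdivrMr// -ler_pdivlMl// mulrC.
by rewrite ltW//; lra.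
Qed.

Lemma weight_subexp (b : weight R) (s : R) : 1 < s ->
  exists2 A : R, 0 < A & forall k, b k <= A * s ^+ k /\ (b k)^-1 <= A * s ^+ k.
Proof.
move=> s1; have s0 : 0 < s by rewrite (lt_trans _ s1).
have [N HN] := weight_near1 b s1.
have [A A0 HA] := growth_bound s0 (@weight_gt0 _ b) (fun k h => (HN k h).1).
have b0 k : 0 < (b k)^-1 by rewrite invr_gt0 weight_gt0.
have [k Nk|A' A'0 HA'] := @growth_bound (fun k => (b k)^-1) N s s0 b0.
  have [_ h] := HN k Nk; have bk := weight_gt0 b k; have bk1 := weight_gt0 b k.+1.
  by rewrite ler_pdivlMr// mulrC ler_pdivrMr.
exists (Num.max A A') => [|k]; first by rewrite lt_max A0.
have sk : 0 <= s ^+ k by rewrite exprn_ge0 ?ltW.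
split; [apply: le_trans (HA k) _|apply: le_trans (HA' k) _].
  by rewrite ler_wpM2r// le_max lexx.
by rewrite ler_wpM2r// le_max lexx orbT.
Qed.

Lemma polynomial_growth_step (b : weight R) : polynomial_growth b ->
  exists2 c : R, 0 <= c & forall k,
    b k.+1 <= (1 + c / k.+1%:R) * b k /\ b k <= (1 + c / k.+1%:R) * b k.+1.
Proof.
move=> pg; have [N HN] := @weight_near1 b 2 ltac:(lra).
pose g k : R := k.+1%:R * `|weight_ratio b k - 1|.
have g_le k : (1 <= k)%N -> ((g k)%:E <= growth_sup b)%E.
  by move=> k1; apply: ereal_sup_ubound; exists k.
have gfin : growth_sup b \is a fin_num.
  rewrite fin_numElt pg andbT (lt_le_trans _ (g_le 1%N _))//; exact: ltNyr.
pose c0 := fine (growth_sup b).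
have gc k : (1 <= k)%N -> g k <= c0.
  by move=> /g_le; rewrite -lee_fin fineK.
have c00 : 0 <= c0 by rewrite (le_trans _ (gc 1%N _))// mulr_ge0.
(* [B] bounds every [b k / b k.+1]: by 2 from index [N] on, by the finite sum before it. It turns a
   bound on [w_k - 1] into one on [1 / w_k - 1]. *)
pose B : R := 2 + \sum_(j < N) b j / b j.+1.
have b0 := @weight_gt0 _ b.
have B2 : 2 <= B by rewrite lerDl sumr_ge0// => j _; rewrite divr_ge0 ?ltW.
have bB k : b k / b k.+1 <= B.
  have [Nk|kN] := leqP N k.
    by rewrite (le_trans _ B2)// ler_pdivrMr//; have [] := HN k Nk.
  rewrite /B (bigD1 (Ordinal kN))//= addrCA lerDl addr_ge0// sumr_ge0// => j _.
  by rewrite divr_ge0 ?ltW.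
exists (c0 * B) => [|k]; first by rewrite mulr_ge0// (le_trans _ B2).
have wk : `|b k.+1 / b k - 1| <= c0 / k.+1%:R.
  rewrite ler_pdivlMr ?ltr0n// mulrC (le_trans _ (gc k.+1 _))// /g /weight_ratio/=.
  by rewrite ler_wpM2r// ler_nat.
have d0 : 0 <= c0 / k.+1%:R by rewrite divr_ge0.
move: wk; rewrite ler_norml => /andP[w1 w2]; split.
  rewrite -ler_pdivrMr//; apply: (@le_trans _ _ (1 + c0 / k.+1%:R)); first by rewrite -lerBlDl.
  by rewrite lerD2l mulrAC ler_peMr// (le_trans _ B2)// ler1n.
have -> : b k = (1 + (1 - b k.+1 / b k) * (b k / b k.+1)) * b k.+1.
  by field; rewrite !gt_eqF.
rewrite ler_wpM2r ?(ltW (b0 _))// lerD2l mulrAC.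
apply: (@le_trans _ _ (c0 / k.+1%:R * (b k / b k.+1))); last exact: ler_wpM2l.
by rewrite ler_wpM2r ?divr_ge0 ?(ltW (b0 _))//; move: w1; rewrite lerNl opprB.
Qed.

(** The ratio [u k / u l] is at most the product of [1 + c / (j + 1)] over [l <= j < k], hence at
    most [expR (c * (k - l) / (l + 1))], where [k - l <= L * (l + 1)]. *)
Lemma step_comparable (u : nat -> R) (c : R) (L l k : nat) : 0 <= c ->
  (forall k, 0 < u k) -> (forall k, u k.+1 <= (1 + c / k.+1%:R) * u k) ->
  (l <= k)%N -> (k.+1 <= L * l.+1)%N -> u k <= expR (c * L%:R) * u l.
Proof.
move=> c0 u0 us lk kL.
have H d : u (l + d)%N <= expR (c * (d%:R / l.+1%:R)) * u l.
  elim: d => [|d ih]; first by rewrite addn0 mul0r mulr0 expR0 mul1r.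
  rewrite addnS (le_trans (us _))//.
  have -> : c * (d.+1%:R / l.+1%:R) = c / l.+1%:R + c * (d%:R / l.+1%:R).
    by rewrite -natr1; ring.
  rewrite expRD -mulrA ler_pM ?(ltW (u0 _))//.
    by rewrite addr_ge0// divr_ge0.
  rewrite (le_trans _ (expR_ge1Dx _))// lerD2l ler_wpM2l// lef_pV2 ?posrE ?ltr0n//.
  by rewrite ler_nat ltnS leq_addr.
have := H (k - l)%N; rewrite subnKC// => /le_trans; apply.
rewrite ler_wpM2r ?(ltW (u0 _))// ler_expR ler_wpM2l//.
rewrite ler_pdivrMr ?ltr0n// -natrM ler_nat (leq_trans _ kL)//.
by rewrite ltnW// ltnS leq_subr.
Qed.

Lemma weight_comparable (b : weight R) (L : nat) : polynomial_growth b ->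
  exists2 E : R, 0 < E & forall k i,
    (k.+1 <= L * i.+1)%N -> (i.+1 <= L * k.+1)%N -> b k <= E * b i.
Proof.
move=> /polynomial_growth_step[c c0 Hc]; exists (expR (c * L%:R)) => [|k i kL iL].
  exact: expR_gt0.
have [ik|/ltnW ki] := leqP i k.
  by apply: (step_comparable c0 (@weight_gt0 _ b)) => // j; have [] := Hc j.
(* For [k < i] the argument is applied to the reciprocal weight, which satisfies the same step
   bound. *)
have b0 j : 0 < (b j)^-1 by rewrite invr_gt0 weight_gt0.
have bk := weight_gt0 b k; have bi := weight_gt0 b i.
have : (b i)^-1 <= expR (c * L%:R) * (b k)^-1.
  apply: (@step_comparable (fun j => (b j)^-1) c L k i c0 b0 _ ki iL) => j.
  have [_ h] := Hc j; have bj := weight_gt0 b j; have bj1 := weight_gt0 b j.+1.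
  by rewrite ler_pdivlMr// mulrC ler_pdivrMr.
by rewrite -[X in X <= _]mul1r ler_pdivrMr// mulrAC ler_pdivlMr// mul1r.
Qed.

End Weighted_matrices.

(** * Weighted bounds for contractions with decaying entries *)

Section Weighted_bound.
Variable R : realType.
Local Notation C := R[i].
Implicit Types (V : nat -> nat -> C) (x : nat -> C) (b : weight R).

(** The constant [c] bounds the square of the operator norm. Only finite sections appear, so no
    convergence has to be settled first. *)
Definition weighted_bounded b V (c : R) := forall m n x,
  \sum_(k < m) normc (\sum_(i < n) V k i * x i) ^+ 2 * b k ^+ 2 <=
  c * \sum_(i < n) normc (x i) ^+ 2 * b i ^+ 2.

Lemma normcD_sqr_le (x y : C) :
  normc (x + y) ^+ 2 <= 2 * (normc x ^+ 2 + normc y ^+ 2).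
Proof.
have h := le_normcD x y; have x0 := normc_ge0 x; have y0 := normc_ge0 y.
apply: (@le_trans _ _ ((normc x + normc y) ^+ 2)).
  by rewrite ler_sqr ?nnegrE ?normc_ge0 ?addr_ge0.
rewrite -subr_ge0.
by rewrite (_ : _ - _ = (normc x - normc y) ^+ 2) ?sqr_ge0//; ring.
Qed.

(* The part of [V] with geometrically small weighted entries is
   Hilbert-Schmidt. *)
Lemma weighted_bounded_geometric b V (D t : R) : 0 <= D -> 0 <= t < 1 ->
  (forall k i, normc (V k i) * b k <= D * (t ^+ k * t ^+ i) * b i) ->
  weighted_bounded b V ((D / (1 - t)) ^+ 2).
Proof.
move=> D0 t01 H m n x; have /andP[t0 t1] := t01.
have t10 : 0 < 1 - t by rewrite subr_gt0.
pose y i := normc (x i) * b i.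
have y0 i : 0 <= y i by rewrite mulr_ge0 ?normc_ge0// ltW// weight_gt0.
have tk0 k : 0 <= t ^+ k by rewrite exprn_ge0.
have tsq k : (t ^+ k) ^+ 2 <= t ^+ k by rewrite expr2 ler_piMl// exprn_ile1// ltW.
set Y := \sum_(i < n) _.
have YE : Y = \sum_(i < n) y i ^+ 2 by apply: eq_bigr => i _; rewrite exprMn.
have Y0 : 0 <= Y by rewrite YE sumr_ge0// => i _; exact: sqr_ge0.
pose s := \sum_(i < n) t ^+ i * y i.
have s0 : 0 <= s by rewrite sumr_ge0// => i _; rewrite mulr_ge0.
have sY : s ^+ 2 <= (1 - t)^-1 * Y.
  rewrite (le_trans (sum_mul_sqr_le _ _ _))// -YE ler_wpM2r//.
  by apply: le_trans (sum_geometric_le n t01); apply: ler_sum => i _.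
(* All rows share the scalar [s], already bounded by Cauchy-Schwarz; only the factor [t ^+ k]
   depends on the row. *)
have row k : normc (\sum_(i < n) V k i * x i) * b k <= D * t ^+ k * s.
  rewrite (le_trans (ler_wpM2r (ltW (weight_gt0 b k)) (normc_sum _ _ _)))//.
  rewrite mulr_suml /s mulr_sumr; apply: ler_sum => i _.
  rewrite normcM mulrAC (le_trans (ler_wpM2r (normc_ge0 _) (H k i)))//.
  by rewrite /y le_eqVlt; apply/orP; left; apply/eqP; ring.
apply: (@le_trans _ _ (\sum_(k < m) t ^+ k * (D ^+ 2 * s ^+ 2))).
  apply: ler_sum => k _; rewrite -exprMn.
  apply: (@le_trans _ _ ((D * t ^+ k * s) ^+ 2)).
    by rewrite ler_sqr ?nnegrE ?row// mulr_ge0 ?normc_ge0 ?mulr_ge0 ?(ltW (weight_gt0 b k)).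
  rewrite (_ : (D * t ^+ k * s) ^+ 2 = (t ^+ k) ^+ 2 * (D ^+ 2 * s ^+ 2)); last by ring.
  rewrite ler_wpM2r//.
  by rewrite mulr_ge0 ?sqr_ge0.
rewrite -mulr_suml exprMn.
have -> : D ^+ 2 * (1 - t)^-1 ^+ 2 * Y = (1 - t)^-1 * (D ^+ 2 * ((1 - t)^-1 * Y)) by ring.
rewrite ler_pM ?sumr_ge0 ?mulr_ge0 ?sqr_ge0 ?sum_geometric_le//.
by rewrite ler_wpM2l ?sqr_ge0.
Qed.

(** * Blocks of indices between consecutive powers of [L] *)

Section Levels.
Variable L : nat.
Hypothesis L1 : (1 < L)%N.
Let lev k := trunc_log L k.+1.
Definition near_level k i := (lev k <= (lev i).+1)%N && (lev i <= (lev k).+1)%N.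

Lemma near_level_le k i : near_level k i -> (k.+1 <= L ^ 2 * i.+1)%N.
Proof.
move=> /andP[ki _]; apply/ltnW; apply: (@leq_trans (L ^ (lev k).+1)).
  by have /andP[] := trunc_log_bounds L1 (ltn0Sn k).
apply: (@leq_trans (L ^ (2 + lev i))).
  by rewrite leq_exp2l// add2n ltnS.
rewrite expnD leq_mul2l; apply/orP; right.
by have /andP[] := trunc_log_bounds L1 (ltn0Sn i).
Qed.

Lemma near_levelC k i : near_level k i = near_level i k.
Proof. by rewrite /near_level andbC. Qed.

(** Between levels that differ by at least two lies a full block, which forces a ratio of at least
    [L]. *)
Lemma far_level k i : ~~ near_level k i ->
  (L * k.+1 <= i.+1)%N || (L * i.+1 <= k.+1)%N.
Proof.
have far u v : ((lev u).+1 < lev v)%N -> (L * u.+1 <= v.+1)%N.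
  move=> uv; apply: (@leq_trans (L ^ lev v)).
    apply: (@leq_trans (L ^ (lev u).+2)); last by rewrite leq_exp2l.
    rewrite expnS leq_mul2l; apply/orP; right; apply/ltnW.
    by have /andP[] := trunc_log_bounds L1 (ltn0Sn u).
  by have /andP[] := trunc_log_bounds L1 (ltn0Sn v).
by rewrite negb_and -!ltnNge => /orP[/far ->|/far ->] //; rewrite orbT.
Qed.

Lemma lev_pred_exp l : lev (L ^ l).-1 = l.
Proof.
by rewrite /lev prednK ?expn_gt0 ?(ltnW L1)// trunc_expnK.
Qed.

(* The weight is constant up to a factor [E] on each block of indices of a given
   level, and [V] contracts the restriction of [x] to three consecutive blocks. *)
Lemma weighted_bounded_near b V (E : R) : contraction V -> 0 <= E ->
  (forall k i, near_level k i -> b k <= E * b i) ->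
  weighted_bounded b (fun k i => if near_level k i then V k i else 0)
    (3 * E ^+ 4).
Proof.
move=> Vc E0 HE m n x.
pose near l i := (l <= (lev i).+1)%N && (lev i <= l.+1)%N.
pose xl l i := if near l i then x i else 0.
(* [r l] is the first index of level [l]; its weight stands for the weight on that level and the
   adjacent ones. *)
pose r l := (L ^ l).-1.
have levr l : lev (r l) = l by exact: lev_pred_exp.
have b0 k : 0 <= b k by rewrite ltW// weight_gt0.
have levm k : (k < m)%N -> (lev k < m)%N.
  move=> km; apply: leq_trans km.
  rewrite -(ltn_exp2l _ _ L1) (leq_ltn_trans (trunc_logP L1 (ltn0Sn k)))//.
  exact: ltn_expl.
have pick1 (F : R) c : (c < m)%N -> F = \sum_(l < m) (if c == l :> nat then F else 0).
  move=> cm; rewrite (bigD1 (Ordinal cm))//= eqxx big1 ?addr0// => l.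
  by rewrite -val_eqE /= eq_sym => /negbTE ->.
have cnt (F : R) c : 0 <= F -> \sum_(l < m) (if c == l :> nat then F else 0) <= F.
  move=> F0; have [/pick1 <- //|cm] := ltnP c m.
  rewrite big1// => l _; case: eqP => // cl.
  by have := ltn_ord l; rewrite -cl ltnNge cm.
(* Rows are grouped by level. A row of level [l] only meets the restriction [xl l] of [x], so the
   full matrix [V] may be applied to it. One factor [E] passes from [b k] to [b (r l)], a second one
   from there to [b i]; squaring gives [E ^+ 4]. *)
apply: (@le_trans _ _ (\sum_(l < m) \sum_(k < m)
    normc (\sum_(i < n) V k i * xl l i) ^+ 2 * (E * b (r l)) ^+ 2)).
  rewrite exchange_big /=; apply: ler_sum => k _.
  rewrite [leLHS](pick1 _ (lev k)) ?levm//; apply: ler_sum => l _.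
  case: eqP => [lk|_]; last by rewrite mulr_ge0 ?sqr_ge0.
  apply: ler_pM; rewrite ?sqr_ge0//.
    rewrite le_eqVlt; apply/orP; left; apply/eqP; congr (normc _ ^+ 2).
    apply: eq_bigr => i _; rewrite /xl /near /near_level lk.
    by case: ifP; rewrite ?mul0r ?mulr0.
  rewrite ler_sqr ?nnegrE ?mulr_ge0//; apply: HE.
  by rewrite /near_level levr lk leqnSn.
apply: (@le_trans _ _ (\sum_(l < m) \sum_(i < n)
    if near l i then E ^+ 4 * (normc (x i) ^+ 2 * b i ^+ 2) else 0)).
  apply: ler_sum => l _; rewrite -mulr_suml.
  rewrite (le_trans (ler_wpM2r (sqr_ge0 _) (Vc _ _ _)))// mulr_suml.
  apply: ler_sum => i _; rewrite /xl; case: ifP => li; last first.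
    by rewrite normc0 expr0n mul0r.
  rewrite [leRHS]mulrCA ler_wpM2l ?sqr_ge0//.
  rewrite (_ : E ^+ 4 * b i ^+ 2 = (E * (E * b i)) ^+ 2); last by ring.
  rewrite ler_sqr ?nnegrE ?mulr_ge0// ler_wpM2l// HE//.
  by rewrite /near_level levr; move: li; rewrite /near.
rewrite exchange_big mulr_sumr; apply: ler_sum => i _ /=.
set F := E ^+ 4 * _.
have F0 : 0 <= F by rewrite mulr_ge0 ?exprn_ge0// mulr_ge0 ?sqr_ge0.
have -> : 3 * E ^+ 4 * (normc (x i) ^+ 2 * b i ^+ 2) = F + F + F by rewrite /F; ring.
(* Each index is near at most three levels, whence the factor 3. At level 0 the predecessor is the
   level itself, which only enlarges the bound. *)
apply: (@le_trans _ _ (\sum_(l < m) ((if lev i == l :> nat then F else 0) +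
  (if (lev i).+1 == l :> nat then F else 0) +
  (if (lev i).-1 == l :> nat then F else 0)))).
  apply: ler_sum => l _; case: ifP => [/andP[h1 h2]|_]; last first.
    by rewrite !addr_ge0//; case: ifP.
  case: eqP => [_|n1]; first by rewrite -addrA lerDl addr_ge0//; case: ifP.
  case: eqP => [_|n2]; first by rewrite add0r lerDl; case: ifP.
  by case: eqP => [_|n3]; [rewrite !add0r|exfalso; lia].
by rewrite !big_split /= !lerD// cnt.
Qed.

End Levels.

Lemma weighted_bounded_add b V W (c d : R) :
  weighted_bounded b V c -> weighted_bounded b W d ->
  weighted_bounded b (fun k i => V k i + W k i) (2 * (c + d)).
Proof.
move=> HV HW m n x; have := HV m n x; have := HW m n x.
set X := \sum_(i < n) normc (x i) ^+ 2 * _ => hW hV.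
apply: (@le_trans _ _ (2 * (c * X + d * X))); last by rewrite -mulrDl mulrA.
rewrite (le_trans _ (ler_wpM2l (ler0n _ _) (lerD hV hW)))//.
rewrite -big_split mulr_sumr; apply: ler_sum => k _ /=.
rewrite -mulrDl mulrA ler_wpM2r ?sqr_ge0//.
rewrite (le_trans _ (normcD_sqr_le _ _))// -big_split /=.
by under [X in _ <= normc X ^+ 2]eq_bigr do rewrite -mulrDl.
Qed.

Lemma weighted_bounded_contraction b V (M q Q : R) : polynomial_growth b ->
  contraction V -> 0 <= M -> 0 < q < 1 -> 1 <= Q ->
  (forall k i, normc (V k i) <= M * (q ^+ i * Q ^+ k)) ->
  (forall k i, normc (V k i) <= M * (Q ^+ i * q ^+ k)) ->
  exists c, weighted_bounded b V c.
Proof.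
move=> pb Vc M0 /andP[q0 q1] Q1 V1 V2.
(* Since [q <= p ^+ 2], one factor [p] of the decay is kept while the other absorbs [Q]. The rate
   [s > 1] chosen next has [p * s < 1], leaving room for the subexponential growth of the weight. *)
pose p := (1 + q) / 2.
have p0 : 0 < p by rewrite /p; lra.
have p1 : p < 1 by rewrite /p; lra.
have qp : q <= p ^+ 2.
  have -> : p ^+ 2 = q + ((1 - q) / 2) ^+ 2 by rewrite /p; field.
  by rewrite lerDl sqr_ge0.
pose s := (1 + p^-1) / 2.
have s1 : 1 < s by rewrite ltr_pdivlMr ?ltr0n// mul1r ltrD2l invf_gt1.
have psE : p * s = (p + 1) / 2 by rewrite /s; field; rewrite gt_eqF.
have ps1 : p * s < 1 by rewrite psE ltr_pdivrMr ?ltr0n// mul1r ltrD2r.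
have ps0 : 0 <= p * s by rewrite mulr_ge0 ?(ltW p0)// (le_trans _ (ltW s1)).
have [A A0 HA] := weight_subexp b s1.
have [N pN] : exists N, p ^+ N.+1 * Q <= 1.
  have Q0 : 0 < Q by rewrite (lt_le_trans _ Q1).
  have Qi : 0 < Q^-1 by rewrite invr_gt0.
  have /cvgrPdist_lt /(_ _ Qi)[N _ HN] := @cvg_expr R p ltac:(by rewrite gtr0_norm).
  exists N; have := HN N.+1 (leqnSn _); rewrite sub0r normrN ger0_norm ?exprn_ge0 ?(ltW p0)//.
  by move=> /ltW; rewrite -ler_pdivlMr// mul1r.
pose L := N.+2.
have Q0 : 0 <= Q by rewrite (le_trans _ Q1).
(* Here [v >= (N + 1) u + u], so the spare factor [p ^+ v] is at most [(p ^+ N.+1) ^+ u * p ^+ u],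
   and [p ^+ N.+1 * Q <= 1] removes [Q ^+ u]. *)
have small u v : (L * u.+1 <= v.+1)%N -> q ^+ v * Q ^+ u <= p ^+ v * p ^+ u.
  move=> uv; apply: (@le_trans _ _ ((p ^+ 2) ^+ v * Q ^+ u)).
    rewrite ler_wpM2r ?exprn_ge0//; apply: lerXn2r; last exact: qp.
      by rewrite nnegrE ltW.
    by rewrite nnegrE exprn_ge0// ltW.
  rewrite -exprM mulSn mul1n exprD -mulrA ler_wpM2l ?exprn_ge0 ?(ltW p0)//.
  apply: (@le_trans _ _ (p ^+ (N.+1 * u + u) * Q ^+ u)).
    rewrite ler_wpM2r ?exprn_ge0 ?Q0// ler_wiXn2l ?(ltW p0) ?(ltW p1)//.
    by rewrite -ltnS (leq_trans _ uv)// -mulSnr mulnS addSn ltnS leq_addl.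
  rewrite exprD mulrAC ler_piMl ?exprn_ge0 ?(ltW p0)// exprM -exprMn.
  by rewrite exprn_ile1// mulr_ge0 ?exprn_ge0 ?(ltW p0) ?Q0.
have L1 : (1 < L)%N by [].
have [E E0 HE] := weight_comparable (L ^ 2) pb.
have near := @weighted_bounded_near L L1 b V E Vc (ltW E0).
have far := @weighted_bounded_geometric b
  (fun k i => if near_level L k i then 0 else V k i) (M * A ^+ 2) (p * s).
eexists; suff -> : V = fun k i => (if near_level L k i then V k i else 0) +
    (if near_level L k i then 0 else V k i).
  apply: weighted_bounded_add; [apply: near => k i ki|apply: far => [||k i]].
  - by apply: HE; apply: near_level_le => //; rewrite near_levelC.
  - by rewrite mulr_ge0 ?sqr_ge0.
  - by rewrite ps0 ps1.
  have bi := weight_gt0 b i; have bk := weight_gt0 b k.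
  case: ifPn => [_|/(far_level L1) ki].
    rewrite normc0 mul0r mulr_ge0 ?(ltW bi)// mulr_ge0//.
      by rewrite mulr_ge0 ?sqr_ge0.
    by rewrite mulr_ge0// exprn_ge0.
  have Vp : normc (V k i) <= M * (p ^+ k * p ^+ i).
    case/orP: ki => /small h.
      by rewrite (le_trans (V1 k i))// ler_wpM2l// [leRHS]mulrC.
    by rewrite (le_trans (V2 k i))// ler_wpM2l// mulrC.
  have [bk_le _] := HA k; have [_ bi_le] := HA i.
  have bk_le' : b k <= A ^+ 2 * (s ^+ k * s ^+ i) * b i.
    rewrite -ler_pdivrMr// (_ : _ * _ = A * s ^+ k * (A * s ^+ i)); last by ring.
    by apply: ler_pM => //; rewrite ?invr_ge0 ltW.
  rewrite (_ : _ * _ * b i = M * (p ^+ k * p ^+ i) * (A ^+ 2 * (s ^+ k * s ^+ i) * b i)).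
    exact: ler_pM (normc_ge0 _) (ltW bk) Vp bk_le'.
  by rewrite !exprMn; move: (p ^+ k) (p ^+ i) (s ^+ k) (s ^+ i) => pk pi' sk si; ring.
by apply/funext => k; apply/funext => i; case: ifP; rewrite ?addr0 ?add0r.
Qed.

End Weighted_bound.

(** * Operators on weighted Hardy spaces *)

Section Complex_limits.
Variable R : realType.
Local Notation C := R[i].
Implicit Types (u v w : nat -> C^o) (l z : C^o).

Lemma cvgC_distP u l : u @ \oo --> l <->
  forall e : R, 0 < e -> \forall n \near \oo, normc (u n - l) < e.
Proof.
split=> [/cvgrPdist_lt H e e0|H].
  have e0' : 0 < e%:C by rewrite ltcR.
  by have := H _ e0'; apply: filterS => n; rewrite distrC normcE ltcR.
apply/cvgrPdist_lt => -[e e'] /= /andP[/eqP -> e0].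
by have := H _ e0; apply: filterS => n h; rewrite distrC normcE ltcR.
Qed.

Lemma cvgC_geometric u l (A q : R) : 0 <= q < 1 ->
  (forall n, normc (u n - l) <= A * q ^+ n) -> u @ \oo --> l.
Proof.
move=> /andP[q0 q1] H; apply/cvgC_distP => e e0.
have : (fun n => A * q ^+ n) @ \oo --> (A * 0 : R).
  by apply: cvgM; [exact: cvg_cst|apply: cvg_expr; rewrite ger0_norm].
rewrite mulr0 => /cvgrPdist_lt /(_ e e0); apply: filterS => n.
by rewrite sub0r normrN => /(le_lt_trans (ler_norm _)); exact: le_lt_trans (H n).
Qed.

Lemma cvgC_uniq u l l' : u @ \oo --> l -> u @ \oo --> l' -> l = l'.
Proof. exact: (cvg_unique (@norm_hausdorff _ _)). Qed.

Lemma cvg_normc u l : u @ \oo --> l -> (fun n => normc (u n)) @ \oo --> normc l.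
Proof.
move=> /cvgC_distP H; apply/cvgrPdist_lt => e e0.
have := H _ e0; apply: filterS => n; apply: le_lt_trans.
rewrite ler_norml; apply/andP; split.
  rewrite lerNl opprB lerBlDr; apply: le_trans (le_normcD _ _).
  by rewrite subrK.
by rewrite lerBlDr -(normcN (u n - l)) opprB; apply: le_trans (le_normcD _ _); rewrite subrK.
Qed.

Lemma cvgC_Re_Im u (x y : R) :
  (fun n => complex.Re (u n)) @ \oo --> x ->
  (fun n => complex.Im (u n)) @ \oo --> y -> u @ \oo --> (x +i* y : C^o).
Proof.
move=> hx hy; apply/cvgC_distP => e e0.
have e20 : 0 < e / 2 by rewrite divr_gt0.
move/cvgrPdist_lt : hx => /(_ _ e20) hx; move/cvgrPdist_lt : hy => /(_ _ e20) hy.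
near=> n.
have -> : u n - (x +i* y) = (complex.Re (u n) - x)%:C + (0 +i* (complex.Im (u n) - y)).
  by case: (u n) => p r; rewrite /= /real_complex_def /=; apply/eqP; rewrite eq_complex /= addr0 add0r !eqxx.
rewrite (le_lt_trans (le_normcD _ _))// (splitr e) ltrD//=.
  rewrite expr0n addr0 sqrtr_sqr distrC; near: n; exact: hx.
rewrite expr0n add0r sqrtr_sqr distrC; near: n; exact: hy.
Unshelve. all: by end_near.
Qed.

Lemma normc_Re z : `|complex.Re z| <= normc z.
Proof.
case: z => x y /=; rewrite -sqrtr_sqr ler_wsqrtr// lerDl sqr_ge0//.
Qed.

Lemma normc_Im z : `|complex.Im z| <= normc z.
Proof.
case: z => x y /=; rewrite -sqrtr_sqr ler_wsqrtr// lerDr sqr_ge0//.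
Qed.

Lemma cvg_real_abs (w : nat -> R) (K : R) :
  (forall n, \sum_(i < n) `|w i| <= K) -> cvgn (series w).
Proof.
move=> H; apply: normed_cvg; apply: nondecreasing_is_cvgn.
  by apply: nondecreasing_series => n _ _; exact: normr_ge0.
by exists K => _ [n _ <-]; have := H n; rewrite -(big_mkord xpredT (fun i => `|w i|)).
Qed.

Lemma cvgC_abs w (K : R) : (forall n, \sum_(i < n) normc (w i) <= K) ->
  cvgn (series w).
Proof.
move=> H.
have hRe : cvgn (series (fun i => complex.Re (w i))).
  by apply: (@cvg_real_abs _ K) => n; apply: le_trans (H n); apply: ler_sum => i _; exact: normc_Re.
have hIm : cvgn (series (fun i => complex.Im (w i))).
  by apply: (@cvg_real_abs _ K) => n; apply: le_trans (H n); apply: ler_sum => i _; exact: normc_Im.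
apply/cvg_ex; exists (limn (series (fun i => complex.Re (w i))) +i* limn (series (fun i => complex.Im (w i))) : C^o).
apply: cvgC_Re_Im.
  rewrite (_ : (fun n => complex.Re (series w n)) = series (fun i => complex.Re (w i)))//.
  by apply/funext => n; rewrite /series /= (raddf_sum (@complex.Re R : Rcomplex R -> R)).
rewrite (_ : (fun n => complex.Im (series w n)) = series (fun i => complex.Im (w i)))//.
by apply/funext => n; rewrite /series /= (raddf_sum (@complex.Im R : Rcomplex R -> R)).
Qed.

Lemma cvgC_sum (I : Type) (r : seq I) (u : I -> nat -> C^o) (l : I -> C^o) :
  (forall j, u j @ \oo --> l j) ->
  (fun n => \sum_(j <- r) u j n) @ \oo --> \sum_(j <- r) l j.
Proof.
move=> ul; elim: r => [|j r ih].
  by under eq_fun do rewrite big_nil; rewrite big_nil; exact: cvg_cst.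
under eq_fun do rewrite big_cons; rewrite big_cons.
exact: cvgD (ul j) ih.
Qed.

End Complex_limits.

Section H2_operators.
Variables (R : realType) (b : weight R).
Local Notation C := R[i].
Implicit Types (f g : H2 b) (v x : nat -> C).

Definition sqnorm f : R := fine (h2sum b f).

Lemma sqnorm_ge0 f : 0 <= sqnorm f.
Proof. by rewrite fine_ge0// h2sum_ge0. Qed.

Lemma h2_normE f : `|f| = (Num.sqrt (sqnorm f))%:C.
Proof. by []. Qed.

Lemma sqnorm_partial f n :
  \sum_(k < n) normc (f k) ^+ 2 * b k ^+ 2 <= sqnorm f.
Proof.
rewrite -lee_fin fineK ?h2sum_fin_num// -sumEFin.
rewrite -(big_mkord xpredT (fun k => (normc (f k) ^+ 2 * b k ^+ 2)%:E)).
by apply: nneseries_lim_ge => k _ _; rewrite lee_fin h2term_ge0.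
Qed.

Lemma h2sum_le (a : nat -> C^o) (M : R) :
  (forall n, \sum_(k < n) normc (a k) ^+ 2 * b k ^+ 2 <= M) ->
  (h2sum b a <= M%:E)%E.
Proof.
move=> H; apply: lime_le.
  by apply: is_cvg_nneseries => k _ _; rewrite lee_fin h2term_ge0.
by apply: nearW => n; rewrite big_mkord sumEFin lee_fin.
Qed.

Lemma h2predP (a : nat -> C^o) (M : R) :
  (forall n, \sum_(k < n) normc (a k) ^+ 2 * b k ^+ 2 <= M) -> a \in h2pred b.
Proof. by move=> H; rewrite inE /=; apply: le_lt_trans (h2sum_le H) (ltry _). Qed.

Lemma sqnorm_le f (M : R) :
  (forall n, \sum_(k < n) normc (f k) ^+ 2 * b k ^+ 2 <= M) -> sqnorm f <= M.
Proof. by move=> H; rewrite -lee_fin fineK ?h2sum_fin_num//; exact: h2sum_le. Qed.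

Lemma sqnorm_cvg f (e : R) : 0 < e ->
  exists n, sqnorm f - e < \sum_(k < n) normc (f k) ^+ 2 * b k ^+ 2.
Proof.
move=> e0; apply: contrapT => /forallNP H.
have : sqnorm f <= sqnorm f - e.
  by apply: sqnorm_le => n; rewrite leNgt; apply/negP/H.
by rewrite leNgt gtrBl e0.
Qed.

Lemma h2_norm_sqr_le (W : normedModType C) (w : W) f (c : R) : 0 <= c ->
  `|w| ^+ 2 <= c%:C * (sqnorm f)%:C -> `|w| <= (Num.sqrt c)%:C * `|f|.
Proof.
move=> c0 H; rewrite h2_normE -rmorphM -sqrtrM//.
rewrite -ler_sqr ?nnegrE ?normr_ge0 ?ler0c ?sqrtr_ge0//.
by rewrite -rmorphXn sqr_sqrtr ?mulr_ge0 ?sqnorm_ge0// rmorphM.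
Qed.

Lemma sqr_norm f : `|f| ^+ 2 = (sqnorm f)%:C.
Proof. by rewrite h2_normE -rmorphXn sqr_sqrtr// sqnorm_ge0. Qed.

Lemma monomial_subproof i : (fun k => (k == i)%:R : C^o) \in h2pred b.
Proof.
apply: (@h2predP _ (b i ^+ 2)) => n.
apply: (@le_trans _ _ (\sum_(k < n) if k == i :> nat then b i ^+ 2 else 0)).
  apply: ler_sum => k _; case: eqP => [->|_].
    by rewrite normc1 expr1n mul1r.
  by rewrite normc0 expr0n mul0r.
have [ni|ni] := ltnP i n.
  rewrite (bigD1 (Ordinal ni))//= eqxx big1 ?addr0// => k.
  by rewrite -val_eqE /= => /negbTE ->.
rewrite big1 ?sqr_ge0// => k _; case: eqP => // ki.
by have := ltn_ord k; rewrite ki ltnNge ni.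
Qed.

Definition monomial i : H2 b := MkH2 (monomial_subproof i).

Lemma monomialE i k : monomial i k = (k == i)%:R. Proof. by []. Qed.

Lemma h2_coefD f g k : (f + g) k = f k + g k. Proof. by []. Qed.
Lemma h2_coefN f k : (- f) k = - f k. Proof. by []. Qed.
Lemma h2_coefZ (c : C) f k : (c *: f) k = c * f k. Proof. by []. Qed.
Lemma h2_coef_sum (I : Type) (r : seq I) (F : I -> H2 b) k :
  (\sum_(i <- r) F i) k = \sum_(i <- r) F i k.
Proof. by elim/big_ind2 : _ => // f x g y <- <-. Qed.

Lemma h2_eq f g : (forall k, f k = g k) -> f = g.
Proof. by move=> fg; apply/val_inj/funext. Qed.

Lemma truncation_coef f n k :
  (f - \sum_(i < n) f i *: monomial i) k = if (k < n)%N then 0 else f k.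
Proof.
rewrite h2_coefD h2_coefN h2_coef_sum.
have -> : \sum_(i < n) (f i *: monomial i) k = if (k < n)%N then f k else 0.
  under eq_bigr do rewrite h2_coefZ monomialE.
  have [kn|kn] := ltnP k n.
    rewrite (bigD1 (Ordinal kn))//= eqxx mulr1 big1 ?addr0// => i.
    by rewrite -val_eqE /= eq_sym => /negbTE ->; rewrite mulr0.
  rewrite big1// => i _; rewrite (_ : (k == i :> nat) = false) ?mulr0//.
  by apply/negbTE; rewrite neq_ltn (leq_trans (ltn_ord i))// orbT.
by case: ifP; rewrite ?subrr ?subr0.
Qed.

Lemma sqnorm_truncation f n :
  sqnorm (f - \sum_(i < n) f i *: monomial i) <=
  sqnorm f - \sum_(k < n) normc (f k) ^+ 2 * b k ^+ 2.
Proof.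
apply: sqnorm_le => m; rewrite lerBrDr.
pose t k := normc (f k) ^+ 2 * b k ^+ 2.
have t0 k : 0 <= t k by exact: h2term_ge0.
under eq_bigr do rewrite truncation_coef.
apply: le_trans (sqnorm_partial f (n + m)).
rewrite big_split_ord /= addrC; apply: lerD => //.
rewrite (eq_bigr (fun k : 'I_m => if (k < n)%N then 0 else t k)); last first.
  by move=> k _; case: ifP => //; rewrite normc0 expr0n mul0r.
have [mn|/ltnW nm] := leqP m n.
  rewrite big1 => [|k _]; last by rewrite (leq_trans (ltn_ord k)).
  by apply: sumr_ge0 => k _; exact: t0.
rewrite -(big_mkord xpredT (fun k => if (k < n)%N then 0 else t k)).
rewrite (big_cat_nat (leq0n n) nm) /= big_nat_cond big1 ?add0r => [|k]; last first.
  by rewrite andbT => /andP[_ ->].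
have -> (F : nat -> R) : \sum_(n <= i < m) F i = \sum_(0 <= i < m - n) F (i + n)%N.
  by rewrite -{1}(add0n n) big_addn.
apply: (@le_trans _ _ (\sum_(0 <= i < m - n) t (n + i)%N)).
  by apply: ler_sum => k _; rewrite ltnNge leq_addl/= addnC.
rewrite -(big_mkord xpredT (fun i => t (n + i)%N)).
by rewrite [leRHS](big_cat_nat (leq0n _) (leq_subr n m))/= lerDl sumr_ge0.
Qed.

(** [A] takes the same value at [f] and at every tail of [f], and the tails have arbitrarily small
    norm. *)
Lemma monomial_dense (W : normedModType C) (A : {linear H2 b -> W}) (c : R) :
  (forall f, `|A f| <= c%:C * `|f|) -> (forall i, A (monomial i) = 0) ->
  forall f, A f = 0.
Proof.
move=> Ac A0 f; apply/eqP; rewrite -normr_eq0.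
have [r r0 rE] : exists2 r : R, 0 <= r & `|A f| = r%:C.
  exists (complex.Re `|A f|); last by rewrite RRe_real// normr_real.
  by rewrite -ler0c RRe_real ?normr_real.
have H n : r ^+ 2 <= c ^+ 2 * (sqnorm f - \sum_(k < n) normc (f k) ^+ 2 * b k ^+ 2).
  pose g := f - \sum_(i < n) f i *: monomial i.
  have Ag : A g = A f.
    rewrite linearB linear_sum big1 ?subr0// => i _.
    by rewrite linearZ /= A0 scaler0.
  apply: le_trans (ler_wpM2l (sqr_ge0 _) (sqnorm_truncation f n)).
  have := Ac g; rewrite Ag rE -(ler_sqr (R := C)) ?nnegrE ?ler0c//; last first.
    by rewrite (le_trans _ (Ac g))// normr_ge0.
  by rewrite exprMn sqr_norm -!rmorphXn -rmorphM lecR.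
rewrite rE (_ : r = 0)//.
apply/eqP; rewrite -sqrf_eq0 eq_le sqr_ge0 andbT.
apply/ler_addgt0Pr => e e0; rewrite add0r.
(* Adding 1 keeps the divisor positive even when [c = 0]. *)
have c1 : 0 < c ^+ 2 + 1 by rewrite ltr_wpDl ?sqr_ge0.
have [n Hn] := sqnorm_cvg f (divr_gt0 e0 c1).
apply: (le_trans (H n)).
apply: (@le_trans _ _ ((c ^+ 2 + 1) * (e / (c ^+ 2 + 1)))); last first.
  by rewrite mulrCA divff ?mulr1// gt_eqF.
apply: ler_pM; rewrite ?sqr_ge0 ?lerDl//.
  by rewrite subr_ge0 sqnorm_partial.
by rewrite lerBlDr -lerBlDl ltW.
Qed.

Lemma monomial_ext (W : normedModType C) (A B : {linear H2 b -> W}) (c d : R) :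
  (forall f, `|A f| <= c%:C * `|f|) -> (forall f, `|B f| <= d%:C * `|f|) ->
  (forall i, A (monomial i) = B (monomial i)) -> A =1 B.
Proof.
move=> Ac Bd AB f; apply/eqP; rewrite -subr_eq0; apply/eqP.
apply: (@monomial_dense W (A \- B) (c + d)) => [g|i] /=.
  by rewrite (le_trans (ler_normB _ _))// rmorphD mulrDl lerD.
by rewrite AB subrr.
Qed.

End H2_operators.

(** * Operators and functionals given by matrices and rows *)

Section Matrix_operators.
Variables (R : realType) (b : weight R).
Local Notation C := R[i].
Implicit Types (f g : H2 b) (v : nat -> C).

Lemma linear_map_of (U V : lmodType C) (F : U -> V) : linear F ->
  exists T : {linear U -> V}, T =1 F.
Proof.
move=> linF; pose F' := F.
pose T : {linear U -> V} :=
  HB.pack F' (GRing.isLinear.Build C U V *:%R F' linF).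
by exists T.
Qed.

Lemma bounded_operatorP (U V : normedModType C) (A : {linear U -> V}) :
  bounded_operator A <->
  exists2 c : R, 0 <= c & forall x, `|A x| <= c%:C * `|x|.
Proof.
split=> [/linear_boundedP[M [Mr H]]|[c c0 H]]; last first.
  apply/linear_boundedP; exists c%:C; split=> [|r cr x].
    by apply/complex_realP; exists c.
  by apply: le_trans (H x) _; rewrite ler_wpM2r// ltW.
have Mr' : M = (complex.Re M)%:C by rewrite RRe_real.
exists (`|complex.Re M| + 1) => [|x]; first by rewrite addr_ge0.
apply: H; rewrite Mr' ltcR (le_lt_trans (ler_norm _))// ltrDl//.
Qed.

(** The sum is the squared norm of the functional [f |-> \sum_i v_i f_i] on [H^2_beta], on finite
    sections. *)
Definition dual_bounded v (c : R) :=
  forall n, \sum_(i < n) normc (v i) ^+ 2 / b i ^+ 2 <= c.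

Lemma dual_bounded_abs v (c : R) f n : dual_bounded v c ->
  (\sum_(i < n) normc (v i * f i)) ^+ 2 <= c * sqnorm f.
Proof.
move=> vc; have bi i : b i != 0 by rewrite gt_eqF// weight_gt0.
rewrite (eq_bigr (fun i : 'I_n => (normc (v i) / b i) * (normc (f i) * b i))); last first.
  by move=> i _; rewrite normcM mulrACA mulVf ?mulr1.
apply: le_trans (sum_mul_sqr_le n (fun i => normc (v i) / b i) (fun i => normc (f i) * b i)) _.
under eq_bigr do rewrite exprMn exprVn.
under [X in _ * X]eq_bigr do rewrite exprMn.
apply: ler_pM; rewrite ?vc ?sqnorm_partial// sumr_ge0// => i _.
  by rewrite divr_ge0 ?sqr_ge0.
by rewrite mulr_ge0 ?sqr_ge0.
Qed.

Lemma dual_bounded_functional v (c : R) : dual_bounded v c ->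
  exists2 A : {linear H2 b -> C^o},
    forall f, series (fun i => v i * f i : C^o) @ \oo --> (A f : C^o) &
    forall f, normc (A f) ^+ 2 <= c * sqnorm f.
Proof.
move=> vc.
have vcvg f : cvgn (series (fun i => v i * f i : C^o)).
  apply: (@cvgC_abs _ _ (1 + c * sqnorm f)) => n.
  have := dual_bounded_abs f n vc; set s := \sum_(i < n) _ => sc.
  (* This gives [s <= 1 + s ^+ 2], which turns the bound on [s ^+ 2] into the one needed for
     absolute convergence. *)
  have : 0 <= (s - 1) ^+ 2 + s by rewrite addr_ge0 ?sqr_ge0// sumr_ge0// => i _; exact: normc_ge0.
  by nra.
have linF : linear (fun f => limn (series (fun i => v i * f i : C^o))).
  move=> a f g; apply: cvgC_uniq (vcvg _) _.
  have -> : series (fun i => v i * (a *: f + g) i : C^o) =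
    (fun n => a *: series (fun i => v i * f i : C^o) n + series (fun i => v i * g i : C^o) n).
    apply/funext => n; rewrite /series /= scaler_sumr -big_split; apply: eq_bigr => i _ /=.
    by rewrite mulrDr [a *: (_ : C^o)]/(a * _) mulrCA.
  by apply: cvgD; [apply: cvgZl_tmp; exact: vcvg|exact: vcvg].
have [A AE] := linear_map_of linF; exists A => f; rewrite AE; first exact: vcvg.
have := cvg_normc (vcvg f); move/(cvgM _) => /(_ _ _ (cvg_normc (vcvg f))) H.
rewrite expr2 -(cvg_lim _ H)//; apply: limr_le; first by apply/cvg_ex; eexists; exact: H.
apply: nearW => n /=; rewrite -expr2 (le_trans _ (dual_bounded_abs f n vc))//.
rewrite ler_sqr ?nnegrE ?normc_ge0 ?sumr_ge0//; last by move=> i _; exact: normc_ge0.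
rewrite /series /= big_mkord; exact: normc_sum.
Qed.

Lemma weighted_bounded_row V (c : R) k : weighted_bounded b V c ->
  dual_bounded (V k) (c / b k ^+ 2).
Proof.
(* The test vector is the Riesz representative of the truncated row for the weighted product; with
   it the hypothesis becomes [S ^+ 2 * b k ^+ 2 <= c * S]. *)
move=> Vc n; pose x i := (V k i)^* / (b i ^+ 2)%:C.
set S := \sum_(i < n) _.
have S0 : 0 <= S by apply: sumr_ge0 => i _; rewrite divr_ge0 ?sqr_ge0.
have bk := weight_gt0 b k.
have Vx : \sum_(i < n) V k i * x i = S%:C.
  rewrite /S rmorph_sum; apply: eq_bigr => i _ /=.
  by rewrite /x mulrA -normc_sqrE -fmorphV -rmorphM.
have xE : \sum_(i < n) normc (x i) ^+ 2 * b i ^+ 2 = S.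
  apply: eq_bigr => i _; have bi := weight_gt0 b i.
  rewrite /x normcM normcV normc_conj normc_real ?sqr_ge0//.
  by field; rewrite gt_eqF.
have := Vc k.+1 n x; rewrite xE big_ord_recr /= Vx normc_real// => H.
have {}H : S ^+ 2 * b k ^+ 2 <= c * S.
  by apply: le_trans H; rewrite lerDr sumr_ge0// => i _; rewrite mulr_ge0 ?sqr_ge0.
have [S00|/negbTE Sn0] := eqVneq S 0.
  rewrite S00 divr_ge0 ?sqr_ge0//.
  (* The instance with no row and one column yields [0 <= c]. *)
  have := Vc 0%N 1%N (fun=> 1); rewrite big_ord0 big_ord1 normc1 expr1n mul1r.
  by rewrite pmulr_lge0// exprn_gt0// weight_gt0.
have S1 : 0 < S by rewrite lt_def Sn0.
by rewrite ler_pdivlMr ?exprn_gt0// -(ler_pM2r S1) mulrAC -expr2.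
Qed.

(** Each row is a bounded functional, which defines the coefficients of [T f]; the bounds on finite
    sections survive the limit in the columns. *)
Lemma matrix_operator V (c : R) : weighted_bounded b V c ->
  exists2 T : {linear H2 b -> H2 b},
    forall f k, series (fun i => V k i * f i : C^o) @ \oo --> (T f k : C^o) &
    forall f, sqnorm (T f) <= c * sqnorm f.
Proof.
move=> Vc.
have /choice[A HA] : forall k, exists A : {linear H2 b -> C^o},
    forall f, series (fun i => V k i * f i : C^o) @ \oo --> (A f : C^o).
  by move=> k; have [A hA _] := dual_bounded_functional (weighted_bounded_row k Vc); exists A.
have c0 : 0 <= c.
  have := Vc 0%N 1%N (fun=> 1); rewrite big_ord0 big_ord1 normc1 expr1n mul1r.
  by rewrite pmulr_lge0// exprn_gt0// weight_gt0.
have Ab f m : \sum_(k < m) normc (A k f) ^+ 2 * b k ^+ 2 <= c * sqnorm f.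
  pose u n := \sum_(k < m) normc (series (fun i => V k i * f i : C^o) n) ^+ 2 * b k ^+ 2.
  have H : u @ \oo --> \sum_(k < m) normc (A k f) ^+ 2 * b k ^+ 2.
    rewrite /u; elim: m {u} => [|m ih].
      under eq_fun do rewrite big_ord0.
      by rewrite big_ord0; exact: cvg_cst.
    under eq_fun do rewrite big_ord_recr.
    rewrite big_ord_recr; apply: cvgD => //=.
    by apply: cvgM; [apply: cvgM; apply: cvg_normc; exact: HA|exact: cvg_cst].
  rewrite -(cvg_lim _ H)//; apply: limr_le; first by apply/cvg_ex; eexists; exact: H.
  apply: nearW => n; rewrite (le_trans _ (ler_wpM2l c0 (sqnorm_partial f n)))//.
  apply: le_trans (Vc m n f); rewrite /u.
  by under eq_bigr do rewrite /series /= big_mkord.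
have Ain f : (fun k => A k f : C^o) \in h2pred b by exact: h2predP (Ab f).
have linF : linear (fun f => MkH2 (Ain f)).
  by move=> a f g; apply: h2_eq => k; rewrite h2_coefD h2_coefZ /= linearP.
have [T TE] := linear_map_of linF.
exists T => f; first by move=> k; rewrite TE; exact: HA.
by rewrite TE; apply: sqnorm_le => n; exact: Ab.
Qed.

Lemma sqnorm_bounded (T : {linear H2 b -> H2 b}) (c : R) : 0 <= c ->
  (forall f, sqnorm (T f) <= c * sqnorm f) ->
  forall f, `|T f| <= (Num.sqrt c)%:C * `|f|.
Proof.
by move=> c0 Tc f; apply: h2_norm_sqr_le => //; rewrite sqr_norm -rmorphM lecR.
Qed.

(** By [weight_subexp], [1 / b i] grows at most like [s ^+ i] with [normc z * s < 1], so the powers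
    of [z] form a row of finite dual norm. *)
Lemma h2_evaluation (z : C) : normc z < 1 ->
  exists2 A : {linear H2 b -> C^o},
    (forall f, series (fun i => z ^+ i * f i : C^o) @ \oo --> (A f : C^o)) /\
    (forall f, h2eval f z = A f) &
    exists2 c : R, 0 <= c & forall f, `|A f| <= c%:C * `|f|.
Proof.
move=> z1; have r0 := normc_ge0 z; set r := normc z in z1 r0 *.
pose s := 1 + (1 - r) / 2.
have s1 : 1 < s by rewrite ltrDl divr_gt0// subr_gt0.
have rs0 : 0 <= r * s by rewrite mulr_ge0// (le_trans _ (ltW s1)).
have rs1 : r * s < 1.
  rewrite -subr_gt0 (_ : 1 - r * s = (1 - r) * (1 - r / 2)); last by rewrite /s; field.
  rewrite mulr_gt0 ?subr_gt0// ltr_pdivrMr ?ltr0n// mul1r (lt_trans z1)// ltr1n//.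
have [K K0 HK] := weight_subexp b s1.
have t01 : 0 <= (r * s) ^+ 2 < 1 by rewrite sqr_ge0/= expr_lt1.
have zb : dual_bounded (fun i => z ^+ i) (K ^+ 2 / (1 - (r * s) ^+ 2)).
  move=> n; apply: le_trans (ler_wpM2l (sqr_ge0 _) (sum_geometric_le n t01)).
  rewrite mulr_sumr; apply: ler_sum => i _.
  rewrite -exprVn -exprMn normcX -/r exprAC -exprMn.
  have bi : 0 <= (b i)^-1 by rewrite invr_ge0 ltW// weight_gt0.
  rewrite ler_sqr ?nnegrE ?mulr_ge0 ?exprn_ge0 ?(ltW K0)//.
  rewrite exprMn mulrCA ler_wpM2l ?exprn_ge0//.
  by have [_] := HK i.
have [A HA HA2] := dual_bounded_functional zb.
set c := K ^+ 2 / _ in zb HA2.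
have c0 : 0 <= c by rewrite divr_ge0 ?sqr_ge0// subr_ge0; case/andP: t01 => _ /ltW.
exists A; first split=> // f.
  rewrite /h2eval; under eq_fun do rewrite mulrC.
  by apply: cvg_lim; [exact: norm_hausdorff|exact: HA].
exists (Num.sqrt c) => [|f]; first exact: sqrtr_ge0.
apply: h2_norm_sqr_le => //; rewrite normcE -rmorphXn -rmorphM lecR; exact: HA2.
Qed.

End Matrix_operators.

Section Shift_and_evaluation.
Variables (R : realType) (b : weight R).
Local Notation C := R[i].
Implicit Types (f g : H2 b).

Lemma scaleCE (x y : C) : x *: (y : C^o) = x * y. Proof. by []. Qed.

Lemma series_delta_cvg (w : nat -> C) i :
  series (fun j => w j * (j == i)%:R : C^o) @ \oo --> (w i : C^o).
Proof.
apply: (@cvg_trans _ ((fun=> w i : C^o) @ \oo)); last exact: cvg_cst.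
apply: near_eq_cvg; exists i.+1 => // n /= ni.
rewrite /series /= big_mkord (bigD1 (Ordinal ni))//= eqxx mulr1 big1 ?addr0// => j.
by rewrite -val_eqE /= => /negbTE ->; rewrite mulr0.
Qed.

Lemma h2_evaluation_monomial (z : C) (A : {linear H2 b -> C^o}) i :
  (forall f, series (fun i => z ^+ i * f i : C^o) @ \oo --> (A f : C^o)) ->
  A (monomial b i) = z ^+ i.
Proof. by move=> HA; apply: cvgC_uniq (HA _) _; exact: series_delta_cvg. Qed.

Lemma matrix_operator_monomial V (c : R) : weighted_bounded b V c ->
  exists2 T : {linear H2 b -> H2 b},
    (forall f k, series (fun i => V k i * f i : C^o) @ \oo --> (T f k : C^o)) /\
    (forall i k, T (monomial b i) k = V k i) &
    exists2 c : R, 0 <= c & forall f, `|T f| <= c%:C * `|f|.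
Proof.
move=> Vc; have [T HT Tc] := matrix_operator Vc.
exists T; first split=> // i k.
  by apply: cvgC_uniq (HT _ _) _; exact: series_delta_cvg.
exists (Num.sqrt `|c|) => [|f]; first exact: sqrtr_ge0.
apply: sqnorm_bounded => // g; rewrite (le_trans (Tc g))// ler_wpM2r ?sqnorm_ge0//.
exact: ler_norm.
Qed.

(** Each row and each column has at most one nonzero entry, so the squares add up without cross
    terms. *)
Lemma weighted_bounded_shift n (c : R) : 0 <= c ->
  (forall i, b (i + n)%N <= c * b i) ->
  weighted_bounded b (fun k i => (k == i + n)%N%:R) (c ^+ 2).
Proof.
move=> c0 Hc m n' x.
have xE k : normc (\sum_(i < n') (k == i + n)%N%:R * x i) ^+ 2 =
    \sum_(i < n') if k == (i + n)%N then normc (x i) ^+ 2 else 0.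
  have [i /eqP ki|H] := pickP (fun i : 'I_n' => k == (i + n)%N).
    have E (j : 'I_n') : j != i -> (k == j + n)%N = false.
      by rewrite -val_eqE ki eqn_add2r eq_sym => /negbTE.
    rewrite (bigD1 i)//= [RHS](bigD1 i)//= {1 3}ki eqxx mul1r.
    rewrite big1 => [|j ji]; last by rewrite E// mul0r.
    by rewrite big1 ?addr0// => j ji; rewrite E.
  rewrite big1 => [|i _]; last by rewrite [_ == _]H mul0r.
  by rewrite big1 ?normc0 ?expr0n// => i _; rewrite [_ == _]H.
under eq_bigr do rewrite xE mulr_suml.
rewrite exchange_big mulr_sumr; apply: ler_sum => i _ /=.
have [im|im] := ltnP (i + n)%N m; last first.
  rewrite big1 => [|k _]; first by rewrite mulr_ge0 ?sqr_ge0// mulr_ge0 ?sqr_ge0.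
  case: eqP => [ki|]; last by rewrite mul0r.
  by have := ltn_ord k; rewrite ki ltnNge im.
rewrite (bigD1 (Ordinal im))//= eqxx big1 => [|k]; last first.
  by rewrite -val_eqE /= => /negbTE ->; rewrite mul0r.
rewrite addr0 [leRHS]mulrCA ler_wpM2l ?sqr_ge0// -exprMn.
have b0 k : 0 <= b k by rewrite ltW// weight_gt0.
by rewrite ler_sqr ?nnegrE ?mulr_ge0.
Qed.

Lemma shift_operator n (c : R) : 0 <= c -> (forall i, b (i + n)%N <= c * b i) ->
  exists2 T : {linear H2 b -> H2 b},
    forall i, T (monomial b i) = monomial b (i + n)%N &
    forall f, `|T f| <= c%:C * `|f|.
Proof.
move=> c0 Hc; have [T HT Tc] := matrix_operator (weighted_bounded_shift c0 Hc).
exists T => [i|f].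
  by apply: h2_eq => k; apply: cvgC_uniq (HT _ _) _; exact: series_delta_cvg.
by have := sqnorm_bounded (sqr_ge0 c) Tc f; rewrite sqrtr_sqr ger0_norm.
Qed.

(** Point evaluation is replaced by a bounded functional [A], so that the multiplication identity
    can be tested on monomials through [monomial_ext]. *)
Lemma is_multiplicationP (phi : C -> C) (M : {linear H2 b -> H2 b}) :
  bounded_operator M ->
  (forall (z : C) (A : {linear H2 b -> C^o}), normc z < 1 ->
    (forall f, series (fun i => z ^+ i * f i : C^o) @ \oo --> (A f : C^o)) ->
    forall c : R, 0 <= c -> (forall f, `|A f| <= c%:C * `|f|) ->
    forall f, A (M f) = phi z * A f) ->
  is_multiplication phi M.
Proof.
move=> Mb H; split=> // f z; rewrite normcE -(rmorph1 (real_complex R)) ltcR => z1.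
have [A [HA AE] [c c0 Ac]] := h2_evaluation b z1.
by rewrite !AE; exact: (H _ _ z1 HA _ c0 Ac).
Qed.

Lemma shift_multiplication (M : {linear H2 b -> H2 b}) n (c : R) : 0 <= c ->
  (forall f, `|M f| <= c%:C * `|f|) ->
  (forall i, M (monomial b i) = monomial b (i + n)%N) ->
  is_multiplication (fun z => z ^+ n) M.
Proof.
move=> c0 Mc Mm; apply: is_multiplicationP; first by apply/bounded_operatorP; exists c.
move=> z A z1 HA d d0 Ad.
apply: (@monomial_ext _ _ C^o (A \o M) ((z ^+ n : C^o) \*: A) (d * c) (normc (z ^+ n) * d)).
- by move=> f /=; rewrite rmorphM -mulrA (le_trans (Ad _))// ler_wpM2l// ler0c.
- by move=> f /=; rewrite normrM rmorphM -mulrA ler_wpM2l.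
- by move=> i /=; rewrite Mm !(h2_evaluation_monomial _ HA) addnC exprD.
Qed.

End Shift_and_evaluation.

(** * Values of the Takenaka-Malmquist functions in the disk *)

Section Takenaka_Malmquist_evaluation.
Variables (R : realType) (al : R) (a : nat -> R[i]) (z : R[i]).
Local Notation C := R[i].
Hypotheses (al1 : al < 1) (ha : zeros_le al a) (z1 : normc z < 1).

Lemma conj_zero_neq1 i : 1 - (a i)^* * z != 0.
Proof.
rewrite subr_eq0; apply/eqP => /(congr1 (@normc R)); rewrite normc1 normcM normc_conj.
apply/eqP; rewrite gt_eqF//; apply: le_lt_trans (zeros_lt1 al1 i ha).
by rewrite ler_piMr ?normc_ge0// ltW.
Qed.

Definition blaschke_factor i : C := (a i - z) / (1 - (a i)^* * z).

Definition tm_value i : C :=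
  (defect (a i))%:C / (1 - (a i)^* * z) * \prod_(l < i) blaschke_factor l.

(** Summation of the recursion defining [state]. For all-pass inputs the boundary term vanishes in
    the limit by [state_cvg0]. *)
Lemma series_state i (f : nat -> C) n :
  \sum_(k < n) z ^+ k * state (a i) f k.+1 * (1 - (a i)^* * z) =
  (defect (a i))%:C * \sum_(k < n) z ^+ k * f k - (a i)^* * (z ^+ n * state (a i) f n).
Proof.
elim: n => [|n ih]; first by rewrite !big_ord0 /=; ring.
by rewrite !big_ord_recr /= ih exprS; ring.
Qed.

Lemma series_output i (f : nat -> C) n :
  \sum_(k < n) z ^+ k * output (a i) f k =
  a i * \sum_(k < n) z ^+ k * f k -
  (defect (a i))%:C * (z * \sum_(k < n) z ^+ k * state (a i) f k.+1 -
    z ^+ n * state (a i) f n).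
Proof.
elim: n => [|n ih]; first by rewrite !big_ord0 /=; ring.
by rewrite !big_ord_recr /= ih /output exprS; ring.
Qed.

Let gen (f : nat -> C) (l : C) :=
  (fun n => \sum_(k < n) z ^+ k * f k : C^o) @ \oo --> (l : C^o).

Lemma state_cvg0 i : (fun n => z ^+ n * state (a i) (allpass a i) n : C^o) @ \oo --> (0 : C^o).
Proof.
have al0 : 0 <= al by rewrite (le_trans _ (ha 0%N)) ?normc_ge0.
pose q := (1 + al) / 2; pose Q := al + 2 / (1 - al).
have q0 : 0 <= q by rewrite divr_ge0 ?addr_ge0.
have q1 : q <= 1 by rewrite ler_pdivrMr ?ltr0n// mul1r lerD2l ltW.
have Q0 : 0 <= Q by rewrite addr_ge0// divr_ge0// subr_ge0 ltW.
apply: (@cvgC_geometric _ _ _ (q * Q * Q ^+ i) (normc z)).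
  by rewrite normc_ge0.
move=> n; rewrite subr0 normcM normcX mulrC ler_wpM2r ?exprn_ge0 ?normc_ge0//.
have M0 : 0 <= q * Q * Q ^+ i by rewrite mulr_ge0 ?exprn_ge0// mulr_ge0.
case: n => [|n]; first by rewrite normc0.
apply: le_trans (tm_decay2 al1 i n ha) _; by rewrite mulrA ler_piMr// exprn_ile1.
Qed.

Lemma tm_gen i l : gen (allpass a i) l ->
  gen (tm a i) ((defect (a i))%:C / (1 - (a i)^* * z) * l).
Proof.
move=> H; have nz := conj_zero_neq1 i.
have -> : (defect (a i))%:C / (1 - (a i)^* * z) * l =
   (1 - (a i)^* * z)^-1 *: ((defect (a i))%:C *: (l : C^o) - (a i)^* *: (0 : C^o)) :> C^o.
  by rewrite scaler0 subr0 scalerA [RHS]/(_ * _) [_ / _]mulrC.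
rewrite /gen (_ : (fun n => _) = (fun n => (1 - (a i)^* * z)^-1 *:
   ((defect (a i))%:C *: (\sum_(k < n) z ^+ k * allpass a i k : C^o) -
    (a i)^* *: (z ^+ n * state (a i) (allpass a i) n : C^o)) : C^o)); last first.
  apply/funext => n; have H' := series_state i (allpass a i) n.
  rewrite -mulr_suml in H'; apply: (mulIf nz).
  by rewrite [LHS]H' [_^-1 *: _]/(_ * _) mulrAC mulVf// mul1r.
apply: cvgZl_tmp; apply: cvgB; first by apply: cvgZl_tmp.
by apply: cvgZl_tmp; exact: state_cvg0.
Qed.

Lemma allpass_gen i : gen (allpass a i) (\prod_(l < i) blaschke_factor l).
Proof.
elim: i => [|i ih].
  rewrite big_ord0 /gen; have := @series_delta_cvg R (fun k => z ^+ k) 0; rewrite expr0.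
  by apply: cvg_trans; apply: near_eq_cvg; apply: nearW => n; rewrite /series /= big_mkord.
rewrite big_ord_recr /=; have nz := conj_zero_neq1 i.
set P := \prod_(l < i) _ in ih *.
have -> : P * blaschke_factor i = a i *: (P : C^o) - (defect (a i))%:C *: (z *: ((defect (a i))%:C / (1 - (a i)^* * z) * P : C^o) - 0) :> C^o.
  rewrite subr0 !scaleCE /blaschke_factor.
  have sE := defect_sqrC (zeros_lt1 al1 i ha).
  set D := 1 - _ in nz *; set s := (defect (a i))%:C in sE *.
  (* With [s ^+ 2 = 1 - |a_i| ^+ 2], the numerator [a_i (1 - a_i^* z) - s ^+ 2 z] reduces to
     [a_i - z]. *)
  transitivity (P * (a i * D - s * s * z) / D).
    by rewrite -mulrA sE /D; congr (_ * (_ / _)); ring.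
  by clearbody D s P; field.
rewrite /gen (_ : (fun n => _) = (fun n => a i *: (\sum_(k < n) z ^+ k * allpass a i k : C^o) -
  (defect (a i))%:C *: (z *: (\sum_(k < n) z ^+ k * tm a i k : C^o) -
    (z ^+ n * state (a i) (allpass a i) n : C^o)) : C^o)); last first.
  by apply/funext => n; exact: series_output.
apply: cvgB; first by apply: cvgZl_tmp.
apply: cvgZl_tmp; apply: cvgB; last exact: state_cvg0.
by apply: cvgZl_tmp; exact: tm_gen ih.
Qed.

Lemma tm_series_cvg i : (fun n => \sum_(k < n) z ^+ k * tm a i k : C^o) @ \oo --> (tm_value i : C^o).
Proof. by have := tm_gen (@allpass_gen i). Qed.

Lemma tm_value_periodic m i : (forall l, a (l + m)%N = a l) ->
  tm_value (i + m)%N = \prod_(l < m) blaschke_factor l * tm_value i.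
Proof.
move=> am; rewrite /tm_value am mulrCA; congr (_ * _).
elim: i => [|i ih]; first by rewrite big_ord0 mulr1.
by rewrite addSn !big_ord_recr /= ih /blaschke_factor am; ring.
Qed.

End Takenaka_Malmquist_evaluation.

(** * Polynomial growth *)

Section Polynomial_growth.
Variable R : realType.
Local Notation C := R[i].

Lemma sum_ord_mul (V : nmodType) n m (F : nat -> V) :
  \sum_(i < n * m) F i = \sum_(l < n) \sum_(j < m) F (l * m + j)%N.
Proof.
rewrite -(big_mkord xpredT F) big_nat_mul big_mkord; apply: eq_bigr => l _.
rewrite -{1}(add0n (l * m)%N) big_addn mulSn addnK big_mkord.
by apply: eq_bigr => j _; rewrite addnC.
Qed.

Lemma divn_mulD l m (j : 'I_m) : ((l * m + j) %/ m)%N = l.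
Proof. by rewrite divnMDl ?(leq_ltn_trans _ (ltn_ord j))// divn_small ?addn0. Qed.

Lemma modn_mulD l m (j : 'I_m) : ((l * m + j) %% m)%N = j.
Proof. by rewrite modnMDl modn_small. Qed.

Lemma eq_mulD l l' m (j j' : 'I_m) :
  ((l * m + j)%N == (l' * m + j')%N) = (l == l') && (j == j').
Proof.
apply/eqP/andP => [H|[/eqP -> /eqP ->]//]; split.
  by rewrite -(divn_mulD l j) H divn_mulD.
by rewrite -val_eqE /= -(modn_mulD l j) H modn_mulD.
Qed.

Lemma exists_bound_lt1 m (a : 'I_m -> C) : (forall j, normc (a j) < 1) ->
  exists2 al : R, 0 <= al < 1 & forall j, normc (a j) <= al.
Proof.
move=> a1; exists (\big[Order.max/0]_j normc (a j)); last by move=> j; exact: le_bigmax.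
apply/andP; split; first by elim/big_rec : _ => // j x _ x0; rewrite le_max normc_ge0.
by elim/big_rec : _ => // j x _ x0; rewrite gt_max a1.
Qed.

(* The matrix of [f |-> \sum_n f_n w^n e_(n m + j)], where [e] is the
   Takenaka-Malmquist basis of the [m]-periodic sequence of zeros. *)
Definition section_matrix m (w : C) (a : nat -> C) (j : 'I_m) (k n : nat) : C :=
  w ^+ n * tm a (n * m + j) k.

Section Blaschke.
Variables (b : weight R) (m : nat) (a : nat -> C) (w : C) (al : R).
Hypotheses (pb : polynomial_growth b) (m1 : (0 < m)%N).
Hypotheses (w1 : normc w = 1) (al0 : 0 <= al) (al1 : al < 1).
Hypotheses (ha : zeros_le al a) (am : forall l, a (l + m)%N = a l).
Let V := @section_matrix m w a.

Lemma section_contraction j : contraction (V j).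
Proof.
(* [y] spreads [x] over the indices [n m + j] with the unimodular phases [w ^+ n], so its norm is
   that of [x]. *)
move=> K N x; pose y i : C := if (i %% m == j)%N then w ^+ (i %/ m) * x (i %/ m)%N else 0.
have red (F : nat -> C -> C) (k : nat) : (forall i, F i 0 = 0) ->
    \sum_(i < N * m) F i (y i) = \sum_(n < N) F (n * m + j)%N (w ^+ n * x n).
  move=> F0; rewrite (sum_ord_mul N m (fun i => F i (y i))); apply: eq_bigr => n _.
  rewrite (bigD1 j)//= big1 ?addr0 => [|j' jj].
    by rewrite /y modn_mulD divn_mulD eqxx.
  by rewrite /y modn_mulD (negbTE (_ : (j' != j :> nat)))// F0.
have := tm_contraction al1 ha K (N * m) y.
have -> : \sum_(i < N * m) normc (y i) ^+ 2 = \sum_(n < N) normc (x n) ^+ 2.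
  rewrite (sum_ord_mul N m (fun i => normc (y i) ^+ 2)); apply: eq_bigr => n _.
  rewrite (bigD1 j)//= big1 ?addr0 => [|j' jj].
    by rewrite /y modn_mulD divn_mulD eqxx normcM normcX w1 expr1n mul1r.
  by rewrite /y modn_mulD (negbTE (_ : (j' != j :> nat)))// normc0 expr0n.
apply: le_trans; apply: ler_sum => k _.
rewrite (red (fun i c => tm a i k * c))//; last by move=> i; rewrite mulr0.
rewrite (eq_bigr (fun n : 'I_N => tm a (n * m + j) k * (w ^+ n * x n))) ?lexx// => n _.
by rewrite /V /section_matrix; ring.
Qed.

Lemma section_decay j : exists M q' Q' : R,
  [/\ 0 <= M, 0 < q' < 1, 1 <= Q',
   forall k n, normc (V j k n) <= M * (q' ^+ n * Q' ^+ k) &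
   forall k n, normc (V j k n) <= M * (Q' ^+ n * q' ^+ k)].
Proof.
pose q := (1 + al) / 2; pose Q := al + 2 / (1 - al).
have q0 : 0 < q by rewrite divr_gt0// ltr_pwDl.
have q1 : q < 1 by rewrite ltr_pdivrMr ?ltr0n// mul1r ltrD2l.
have a10 : 0 < 1 - al by rewrite subr_gt0.
have Q1 : 1 <= Q.
  rewrite -lerBlDl ler_pdivlMr//.
  apply: (@le_trans _ _ (1 * 1)); last by rewrite mulr1 ler1n.
  by rewrite ler_pM ?gerBl// ltW.
have Q0 : 0 <= Q by rewrite (le_trans _ Q1).
have nj n : (n <= n * m + j)%N by rewrite (leq_trans (leq_pmulr n m1))// leq_addr.
have nw k n : normc (V j k n) = normc (tm a (n * m + j) k).
  by rewrite /V /section_matrix normcM normcX w1 expr1n mul1r.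
have Qm : Q <= Q ^+ m by rewrite -[leLHS]expr1 ler_weXn2l.
(* The rate and the extra factor in the constant come from
   [Q ^+ (n m + j) <= Q ^+ m * (Q ^+ m) ^+ n]; for the powers of [q] the inequality [n <= n m + j]
   suffices. *)
exists (Q * q * Q ^+ m), q, (Q ^+ m); split.
- by rewrite mulr_ge0 ?exprn_ge0// mulr_ge0// ltW.
- by rewrite q0.
- by rewrite (le_trans Q1).
- move=> k n; rewrite nw; apply: le_trans (tm_decay1 al1 _ k ha) _.
  rewrite -/q -/Q -[leRHS]mulrA; apply: ler_wpM2l.
    by rewrite mulr_ge0// ltW.
  apply: (@le_trans _ _ (q ^+ n * (Q ^+ m) ^+ k)).
    apply: ler_pM; rewrite ?exprn_ge0 ?(ltW q0)//.
      by rewrite ler_wiXn2l ?(ltW q0) ?(ltW q1).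
    by rewrite lerXn2r// nnegrE ?exprn_ge0.
  by rewrite ler_peMl ?mulr_ge0 ?exprn_ge0 ?(ltW q0)// (le_trans Q1).
- move=> k n; rewrite nw; apply: le_trans (tm_decay2 al1 _ k ha) _.
  rewrite -/q -/Q [q * Q]mulrC -[leRHS]mulrA; apply: ler_wpM2l.
    by rewrite mulr_ge0// ltW.
  rewrite mulrA ler_wpM2r ?exprn_ge0 ?(ltW q0)// exprD -exprM [(n * m)%N]mulnC mulrC.
  by rewrite ler_wpM2r ?exprn_ge0// ler_weXn2l// ltnW.
Qed.

Lemma section_bounded j : exists c, weighted_bounded b (V j) c.
Proof.
have [M [q [Q [M0 q01 Q1 V1 V2]]]] := section_decay j.
exact: weighted_bounded_contraction pb (@section_contraction j) M0 q01 Q1 V1 V2.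
Qed.

Lemma section_adjoint_bounded j :
  exists c, weighted_bounded b (fun n k => (V j k n)^*) c.
Proof.
have [M [q [Q [M0 q01 Q1 V1 V2]]]] := section_decay j.
apply: weighted_bounded_contraction pb (contraction_adjoint (@section_contraction j)) M0 q01 Q1 _ _.
  by move=> n k; rewrite normc_conj [X in M * X]mulrC.
by move=> n k; rewrite normc_conj [X in M * X]mulrC.
Qed.

(** The phases contribute a factor of modulus 1, which equals 1 in the only case where the limit is
    not 0. *)
Lemma section_orthonormal i j n n' :
  series (fun k => (V i k n')^* * V j k n : C^o) @ \oo -->
  (((i == j) && (n' == n))%:R : C^o).
Proof.
have [A HA] := tm_orthonormal al1 (n * m + j) (n' * m + i) ha.
apply: (@cvgC_geometric _ _ _ A ((1 + al) / 2)).
  by rewrite divr_ge0 ?addr_ge0//= ltr_pdivrMr ?ltr0n// mul1r ltrD2l.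
move=> K; apply: le_trans (HA K); rewrite /series /= big_mkord.
rewrite eq_mulD [j == i]eq_sym [n == n']eq_sym [(n' == n) && _]andbC.
have -> : \sum_(k < K) (V i k n')^* * V j k n =
    (w ^+ n')^* * w ^+ n * \sum_(k < K) tm a (n * m + j) k * (tm a (n' * m + i) k)^*.
  rewrite mulr_sumr; apply: eq_bigr => k _.
  by rewrite /V /section_matrix rmorphM /=; ring.
set S := \sum_(k < K) _.
have nw : normc ((w ^+ n')^* * w ^+ n) = 1.
  by rewrite normcM normc_conj !normcX w1 !expr1n mul1r.
have [/andP[_ /eqP nn]|_] := boolP ((i == j) && (n' == n)).
  rewrite nn [_^* * _]mulrC -normc_sqrE normcX w1 !expr1n mul1r//.
by rewrite !subr0 normcM nw mul1r.
Qed.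

(** [N] terms of each of the [m] series make up the first [N m] basis functions, and the phases
    cancel, so [tm_complete] applies. *)
Lemma section_complete k l :
  (fun N => \sum_j series (fun n => V j k n * (V j l n)^* : C^o) N : C^o) @ \oo -->
  ((k == l)%:R : C^o).
Proof.
have [A HA] := tm_complete al1 k l ha.
have q0 : 0 <= (1 + al) / 2 by rewrite divr_ge0 ?addr_ge0.
have q1 : (1 + al) / 2 < 1 by rewrite ltr_pdivrMr ?ltr0n// mul1r ltrD2l.
apply: (@cvgC_geometric _ _ _ `|A| ((1 + al) / 2)); first by rewrite q0 q1.
move=> N; have -> : \sum_j series (fun n => V j k n * (V j l n)^* : C^o) N =
    \sum_(i < N * m) tm a i k * (tm a i l)^*.
  rewrite (sum_ord_mul N m (fun i => tm a i k * (tm a i l)^*)) [RHS]exchange_big /=.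
  apply: eq_bigr => j _; rewrite /series /= big_mkord; apply: eq_bigr => n _.
  rewrite /V /section_matrix rmorphM /= mulrACA -normc_sqrE normcX w1 !expr1n mul1r//.
apply: le_trans (HA (N * m)%N) _.
apply: le_trans (ler_wpM2r _ (ler_norm A)) _; first by rewrite exprn_ge0.
by rewrite ler_wpM2l// ler_wiXn2l ?(ltW q1)// leq_pmulr.
Qed.

(** Here multiplication by the Blaschke product becomes the shift of columns: [w] supplies the next
    phase, and one period of zeros advances the index by [m]. *)
Lemma section_value (z : C) j n : normc z < 1 ->
  exists2 u : C, series (fun k => z ^+ k * V j k n : C^o) @ \oo --> (u : C^o) &
  series (fun k => z ^+ k * V j k n.+1 : C^o) @ \oo -->
  (w * \prod_(l < m) ((a l - z) / (1 - (a l)^* * z)) * u : C^o).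
Proof.
move=> z1; have H n' : series (fun k => z ^+ k * V j k n' : C^o) @ \oo -->
    (w ^+ n' * tm_value a z (n' * m + j) : C^o).
  rewrite (_ : series _ = fun K => w ^+ n' *: (\sum_(k < K) z ^+ k * tm a (n' * m + j) k : C^o)).
    by apply: cvgZl_tmp; exact: (@tm_series_cvg _ al).
  apply/funext => K; rewrite /series /= big_mkord scaleCE mulr_sumr.
  by apply: eq_bigr => k _; rewrite /V /section_matrix; ring.
exists (w ^+ n * tm_value a z (n * m + j)); first exact: H.
suff -> : w * \prod_(l < m) ((a l - z) / (1 - (a l)^* * z)) *
  (w ^+ n * tm_value a z (n * m + j)) = w ^+ n.+1 * tm_value a z (n.+1 * m + j).
  exact: H.
have -> : (n.+1 * m + j = n * m + j + m)%N by rewrite mulSn -addnA addnC.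
by rewrite (tm_value_periodic _ _ am) exprS mulrACA.
Qed.

End Blaschke.

End Polynomial_growth.

(** * Bounded operators into, out of and on finite Hilbert sums *)

Section Hilbert_sum_bounds.
Variables (R : realType) (m : nat).
Local Notation C := R[i].

Lemma bounded_operator_comp (U V W : normedModType C) (A : {linear V -> W})
    (B : {linear U -> V}) :
  bounded_operator A -> bounded_operator B -> bounded_operator (A \o B).
Proof.
move=> /bounded_operatorP[c c0 Ac] /bounded_operatorP[d d0 Bd].
apply/bounded_operatorP; exists (c * d) => [|x /=]; first exact: mulr_ge0.
apply: le_trans (Ac _) _; rewrite rmorphM -mulrA; apply: ler_wpM2l; first by rewrite ler0c.
exact: Bd.
Qed.

Variable V : normedModType C.
Implicit Type f : hsum m V.

Lemma hsum_component_le f j : `|f j| <= `|f|.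
Proof.
have -> : `|f| = sqrtC (\sum_i `|f i| ^+ 2) by [].
have S0 : 0 <= \sum_i `|f i| ^+ 2 by apply: sumr_ge0 => i _; rewrite exprn_ge0.
rewrite -[leLHS]sqrCK// ler_sqrtC ?nnegrE ?exprn_ge0//.
by rewrite (bigD1 j)//= lerDl sumr_ge0// => i _; rewrite exprn_ge0.
Qed.

Lemma hsum_norm_le f : `|f| <= \sum_j `|f j|.
Proof.
have -> : `|f| = sqrtC (\sum_i `|f i| ^+ 2) by [].
have S0 : 0 <= \sum_j `|f j| by apply: sumr_ge0.
rewrite -[leRHS]sqrCK// ler_sqrtC ?nnegrE ?exprn_ge0//; last first.
  by apply: sumr_ge0 => i _; rewrite exprn_ge0.
rewrite expr2 mulr_suml; apply: ler_sum => i _; rewrite expr2 ler_wpM2l//.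
by rewrite (bigD1 i)//= lerDl sumr_ge0.
Qed.

Lemma bounded_hsum_op (A : {linear V -> V}) :
  bounded_operator A -> bounded_operator (hsum_op m A).
Proof.
move=> /bounded_operatorP[c c0 Ac]; apply/bounded_operatorP.
exists (c *+ m) => [|f]; first by rewrite mulrn_wge0.
apply: le_trans (hsum_norm_le _) _.
rewrite rmorphMn /= mulrnAl -[X in _ *+ X]card_ord -sumr_const.
apply: ler_sum => j _; rewrite ffunE (le_trans (Ac _))// ler_wpM2l ?ler0c//.
exact: hsum_component_le.
Qed.

Lemma hsum_synthesis (X : 'I_m -> {linear V -> V}) :
  (forall j, bounded_operator (X j)) ->
  exists2 T : {linear hsum m V -> V}, bounded_operator T &
    forall f, T f = \sum_j X j (f j).
Proof.
move=> Xb; have linT : linear (fun f : hsum m V => \sum_j X j (f j)).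
  move=> c f g; rewrite scaler_sumr -big_split; apply: eq_bigr => j _ /=.
  by rewrite !ffunE linearP.
have [T TE] := linear_map_of linT; exists T => //; apply/bounded_operatorP.
have /choice[c Hc] : forall j, exists c : R, 0 <= c /\ forall x, `|X j x| <= c%:C * `|x|.
  by move=> j; have /bounded_operatorP[c] := Xb j; exists c.
exists (\sum_j c j) => [|f]; first by apply: sumr_ge0 => j _; have [] := Hc j.
rewrite TE (le_trans (ler_norm_sum _ _ _))// rmorph_sum mulr_suml.
apply: ler_sum => j _; have [cj0 cj] := Hc j.
by rewrite (le_trans (cj _))// ler_wpM2l ?ler0c// hsum_component_le.
Qed.

Lemma hsum_analysis (Y : 'I_m -> {linear V -> V}) :
  (forall j, bounded_operator (Y j)) ->
  exists2 T : {linear V -> hsum m V}, bounded_operator T &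
    forall x j, T x j = Y j x.
Proof.
move=> Yb; have linT : linear (fun x => [ffun j => Y j x] : hsum m V).
  by move=> c x y; apply/ffunP => j; rewrite !ffunE linearP.
have [T TE] := linear_map_of linT; exists T => [|x j]; last by rewrite TE ffunE.
apply/bounded_operatorP.
have /choice[c Hc] : forall j, exists c : R, 0 <= c /\ forall x, `|Y j x| <= c%:C * `|x|.
  by move=> j; have /bounded_operatorP[c] := Yb j; exists c.
exists (\sum_j c j) => [|x]; first by apply: sumr_ge0 => j _; have [] := Hc j.
apply: le_trans (hsum_norm_le _) _; rewrite rmorph_sum mulr_suml.
by apply: ler_sum => j _; have [cj0 cj] := Hc j; rewrite TE ffunE.
Qed.

End Hilbert_sum_bounds.

Theorem polynomial_growth_similar (R : realType) (m : nat) (B : R[i] -> R[i]) (b : weight R) :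
  finite_blaschke m B -> polynomial_growth b ->
  exists MB Mz : {linear H2 b -> H2 b},
    [/\ is_multiplication B MB, is_multiplication (fun z => z) Mz
      & similar_operators MB (hsum_op m Mz)].
Proof.
move=> [m1 [th [a0 [a1 BE]]]] pb.
pose w : R[i] := cos th +i* sin th.
have w1 : normc w = 1 by rewrite /= cos2Dsin2 sqrtr1.
have a1' j : normc (a0 j) < 1 by have := a1 j; rewrite normcE -(rmorph1 (real_complex R)) ltcR.
have [al /andP[al0 al1] ale] := exists_bound_lt1 a1'.
pose a l := a0 (Ordinal (ltn_pmod l m1)).
have ha : zeros_le al a by move=> i; exact: ale.
have am l : a (l + m)%N = a l by congr a0; apply/val_inj => /=; rewrite modnDr.
have aE (j : 'I_m) : a j = a0 j by congr a0; apply/val_inj => /=; rewrite modn_small.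
pose V := @section_matrix R m w a.
(* [X j] embeds the j-th copy; [Y j] below is given by the adjoint matrix for the unweighted
   product, so its weighted bound is a separate fact. *)
have /choice[X HX] : forall j, exists T : {linear H2 b -> H2 b},
    [/\ forall (f : H2 b) k, series (fun i => V j k i * f i : R[i]^o) @ \oo --> (T f k : R[i]^o),
     forall i k, T (monomial b i) k = V j k i & bounded_operator T].
  move=> j; have [c Hc] := section_bounded pb m1 w1 al0 al1 ha j.
  have [T [T0 T1] T2] := matrix_operator_monomial Hc.
  by exists T; split=> //; apply/bounded_operatorP.
have /choice[Y HY] : forall j, exists T : {linear H2 b -> H2 b},
    [/\ forall (f : H2 b) k, series (fun i => (V j i k)^* * f i : R[i]^o) @ \oo --> (T f k : R[i]^o),
     forall i k, T (monomial b i) k = (V j i k)^* & bounded_operator T].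
  move=> j; have [c Hc] := section_adjoint_bounded pb m1 w1 al0 al1 ha j.
  have [T [T0 T1] T2] := matrix_operator_monomial Hc.
  by exists T; split=> //; apply/bounded_operatorP.
have Xcvg j : forall (f : H2 b) k, series (fun i => V j k i * f i : R[i]^o) @ \oo --> (X j f k : R[i]^o).
  by have [] := HX j.
have Ycvg j : forall (f : H2 b) k, series (fun i => (V j i k)^* * f i : R[i]^o) @ \oo --> (Y j f k : R[i]^o).
  by have [] := HY j.
have X1 j i k : X j (monomial b i) k = V j k i by have [] := HX j.
have Y1 j i k : Y j (monomial b i) k = (V j i k)^* by have [] := HY j.
have Xb j : bounded_operator (X j) by have [] := HX j.
have Yb j : bounded_operator (Y j) by have [] := HY j.
have [c0 c00 bc] := polynomial_growth_step pb.
have c01 : 0 <= 1 + c0 by rewrite addr_ge0.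
have bc' i : b (i + 1)%N <= (1 + c0) * b i.
  rewrite addn1 (le_trans (bc i).1)//; apply: ler_wpM2r; first by rewrite ltW ?weight_gt0.
  by rewrite lerD2l ler_pdivrMr ?ltr0n//; apply: ler_peMr; rewrite ?ler1n.
have [Mz Mz1 Mzb] := shift_operator c01 bc'.
have Mz_bounded : bounded_operator Mz.
  by apply/bounded_operatorP; exists (1 + c0).
have [XL XLb XLE] := hsum_synthesis Xb.
have [YL YLb YLE] := hsum_analysis Yb.
(* Orthonormality, read on monomials. *)
have YX_comp i j f : Y i (X j f) = (i == j)%:R *: f.
  have /bounded_operatorP[c c1 Hc] := bounded_operator_comp (Yb i) (Xb j).
  apply: (@monomial_ext _ _ _ (Y i \o X j) ((i == j)%:R \*: idfun) c 1) => // [g|n] /=.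
    by rewrite normrZ rmorph1 ler_wpM2r// normr_nat lern1; case: eqP.
  apply: h2_eq => k; apply: cvgC_uniq (Ycvg _ _ _) _; rewrite h2_coefZ monomialE.
  rewrite -natrM mulnb; under eq_fun do rewrite X1.
  exact: (@section_orthonormal _ m a w al).
have YX : cancel XL YL.
  move=> f; apply/ffunP => i; rewrite YLE XLE linear_sum (bigD1 i)//= YX_comp eqxx scale1r.
  by rewrite big1 ?addr0// => j ji; rewrite YX_comp eq_sym (negbTE ji) scale0r.
(* Completeness, read on monomials. *)
have XY : cancel YL XL.
  have /bounded_operatorP[c c1 Hc] := bounded_operator_comp XLb YLb.
  apply: (@monomial_ext _ _ _ (XL \o YL) idfun c 1) => // [g|l] /=; first by rewrite mul1r.
  apply: h2_eq => k; rewrite XLE h2_coef_sum monomialE.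
  apply: cvgC_uniq _ (@section_complete _ m a w al m1 w1 al0 al1 ha k l).
  apply: cvgC_sum => j; rewrite YLE.
  have : series (fun n => V j k n * (V j l n)^* : R[i]^o) @ \oo -->
      (X j (Y j (monomial b l)) k : R[i]^o).
    by under eq_fun do rewrite -Y1; exact: Xcvg.
  exact.
(* With [MB] defined by transport, similarity is immediate; what remains is that [MB] multiplies by
   [B]. *)
exists (XL \o (hsum_op m Mz \o YL)), Mz; split.
- apply: is_multiplicationP.
    by do 2 apply: bounded_operator_comp => //; exact: bounded_hsum_op.
  move=> z A z1 HA c c1 Ac f /=.
  have Ab : bounded_operator A by apply/bounded_operatorP; exists c.
  have BzE : B z = w * \prod_(l < m) ((a l - z) / (1 - (a l)^* * z)).
    rewrite BE; last by rewrite normcE -(rmorph1 (real_complex R)) ltcR.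
    by congr (_ * _); apply: eq_bigr => j _; rewrite aE.
  (* Both sides are bounded functionals of [h]; on the monomial of degree [n] the identity is
     [section_value]. *)
  have comp j h : A (X j (Mz h)) = B z * A (X j h).
    have /bounded_operatorP[d d0 Hd] := bounded_operator_comp Ab (bounded_operator_comp (Xb j) Mz_bounded).
    have /bounded_operatorP[e e0 He] := bounded_operator_comp Ab (Xb j).
    apply: (@monomial_ext _ _ R[i]^o (A \o (X j \o Mz)) ((B z : R[i]^o) \*: (A \o X j)) d (normc (B z) * e)) => //.
      move=> g /=; rewrite normrM rmorphM -mulrA; apply: ler_wpM2l => //.
      exact: He.
    move=> n /=; rewrite Mz1 addn1.
    have [u Hu Hu1] := section_value w al1 ha am j n z1.
    have AX n' u' : series (fun k => z ^+ k * V j k n' : R[i]^o) @ \oo --> (u' : R[i]^o) ->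
        A (X j (monomial b n')) = u'.
      move=> H; apply: cvgC_uniq (HA _) _.
      by under eq_fun do rewrite X1.
    by rewrite (AX _ _ Hu) (AX _ _ Hu1) BzE.
  rewrite -{2}(XY f) !XLE !linear_sum /= mulr_sumr.
  by apply: eq_bigr => j _; rewrite ffunE comp.
- exact: (@shift_multiplication _ _ _ 1 (1 + c0)).
- exists YL, XL; split=> // f /=.
  by rewrite YX.
Qed.

(** * Intermediate growth *)

Section Intermediate_growth.
Variable R : realType.
Local Notation C := R[i].
Local Notation sqrtn n := (Num.sqrt (n%:R : R)).

Definition sqrt_exp_seq (n : nat) : R := expR (sqrtn n).

Lemma sqrtn_step k :
  (sqrtn k.+1 - sqrtn k) * (sqrtn k.+1 + sqrtn k) = 1.
Proof.
by rewrite -subr_sqr !sqr_sqrtr ?ler0n// -natr1 addrAC subrr add0r.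
Qed.

(** The increment of the square root lies between [1 / (2 sqrt (k + 1))] and [1 / sqrt (k + 1)]. The
    upper bound gives [w_k -> 1], the lower bound in the next lemma gives intermediate growth. *)
Lemma sqrtn_step_le k : (sqrtn k.+1 - sqrtn k) * sqrtn k.+1 <= 1.
Proof.
rewrite -[leRHS](sqrtn_step k); apply: ler_wpM2l; last by rewrite lerDl sqrtr_ge0.
by rewrite subr_ge0 ler_wsqrtr// ler_nat.
Qed.

Lemma sqrtn_step_ge k : 1 <= (sqrtn k.+1 - sqrtn k) * (2 * sqrtn k.+1).
Proof.
have h : sqrtn k <= sqrtn k.+1 by rewrite ler_wsqrtr// ler_nat leqnSn.
rewrite -[leLHS](sqrtn_step k); apply: ler_wpM2l; first by rewrite subr_ge0.
by rewrite mulr_natl mulr2n lerD2l.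
Qed.

Lemma sqrtn_step_cvg0 : (fun k => sqrtn k.+1 - sqrtn k) @ \oo --> (0 : R).
Proof.
(* Beyond this index [k + 1 > e ^- 2], that is [e * sqrt (k + 1) > 1]. *)
apply/cvgrPdist_lt => e e0; exists (Num.trunc (e ^- 2)).+1 => // k /= Nk.
have d0 : 0 <= sqrtn k.+1 - sqrtn k by rewrite subr_ge0 ler_wsqrtr// ler_nat leqnSn.
rewrite sub0r normrN ger0_norm// ltNge; apply/negP => ed.
have : e * sqrtn k.+1 <= 1.
  by apply: le_trans (sqrtn_step_le k); rewrite ler_wpM2r ?sqrtr_ge0.
apply/negP; rewrite -ltNge -(ltr_pXn2r (n := 2))// ?nnegrE ?mulr_ge0 ?sqrtr_ge0 ?(ltW e0)//.
rewrite expr1n exprMn sqr_sqrtr ?ler0n// mulrC -ltr_pdivrMr ?exprn_gt0// div1r.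
apply: lt_trans (truncnS_gt _) _; rewrite ltr_nat ltnS//.
Qed.

Lemma sqrt_exp_ratio k :
  weight_ratio sqrt_exp_seq k.+1 = expR (sqrtn k.+1 - sqrtn k).
Proof. by rewrite /weight_ratio /sqrt_exp_seq /= expRB. Qed.

Lemma sqrt_exp_ratio_cvg : weight_ratio sqrt_exp_seq @ \oo --> (1 : R).
Proof.
rewrite -cvg_shiftS; under eq_fun do rewrite /= sqrt_exp_ratio.
have H : (expR \o (fun k => sqrtn k.+1 - sqrtn k)) @ \oo --> expR (0 : R).
  by apply: continuous_cvg; [exact: continuous_expR|exact: sqrtn_step_cvg0].
by rewrite expR0 in H.
Qed.

Lemma sqrt_exp0 : sqrt_exp_seq 0 = 1.
Proof. by rewrite /sqrt_exp_seq sqrtr0 expR0. Qed.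

Definition sqrt_exp : weight R :=
  Weight (fun k => expR_gt0 (sqrtn k)) sqrt_exp0 sqrt_exp_ratio_cvg.

Lemma sqrtn_sqr n : sqrtn (n ^ 2) = n%:R.
Proof. by rewrite natrX sqrtr_sqr ger0_norm. Qed.

Lemma sqrt_exp_intermediate : intermediate_growth sqrt_exp.
Proof.
(* At the perfect square [N ^ 2] the increment is at least [1 / (2 N)], so the product is at least
   [N / 2 >= M]. *)
apply/eqyP => M M0; pose N := (Num.trunc (2 * M)).+1.
apply: (@le_trans _ _ ((N ^ 2).+1%:R * `|weight_ratio sqrt_exp (N ^ 2) - 1|)%:E); last first.
  by apply: ereal_sup_ubound; exists (N ^ 2)%N.
rewrite lee_fin.
have : (0 < N ^ 2)%N by rewrite expn_gt0.
case E : (N ^ 2)%N => [//|k] _; rewrite [weight_ratio _ _]sqrt_exp_ratio.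
set d := sqrtn k.+1 - sqrtn k.
have h := sqrtn_step_ge k; rewrite -/d -E sqrtn_sqr in h.
have Npos : 0 < N%:R :> R by rewrite ltr0n.
have d0 : 0 <= d by rewrite subr_ge0 ler_wsqrtr// ler_nat leqnSn.
have MN : 2 * M <= N%:R by rewrite ltW// truncnS_gt.
apply: (@le_trans _ _ (k.+1%:R * d)).
  rewrite -E natrX expr2 -mulrA; apply: le_trans (_ : N%:R * 2^-1 <= _).
    by rewrite ler_pdivlMr// mulrC.
  rewrite ler_wpM2l ?(ltW Npos)// -[2^-1]mul1r ler_pdivrMr//.
  by rewrite (_ : _ * 2 = d * (2 * N%:R)); [exact: h|ring].
apply: ler_pM => //; first by rewrite ler_nat.
rewrite (le_trans _ (ler_norm _))// lerBrDl; exact: expR_ge1Dx.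
Qed.

Lemma sqrt_exp_submult n i : sqrt_exp (i + n)%N <= sqrt_exp n * sqrt_exp i.
Proof.
rewrite -expRD ler_expR -ler_sqr ?nnegrE ?addr_ge0 ?sqrtr_ge0//.
by rewrite sqrrD !sqr_sqrtr ?ler0n// natrD addrC addrAC lerDl mulrn_wge0.
Qed.

(** All zeros are at 0, where each factor is [- z]; even order removes the sign. *)
Lemma finite_blaschke_exp m : (0 < m)%N -> ~~ odd m ->
  finite_blaschke m (fun z : C => z ^+ m).
Proof.
move=> m0 m2; split=> //; exists 0, (fun=> 0); split=> [j|z _]; first by rewrite normr0.
rewrite cos0 sin0 [_ +i* _](_ : _ = 1)// mul1r prodr_const card_ord conjC0 mul0r subr0.
by rewrite divr1 sub0r exprNn -signr_odd (negbTE m2) mul1r.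
Qed.

Lemma monomial_norm_ge (b : weight R) i : (b i)%:C <= `|monomial b i|.
Proof.
have bi := weight_gt0 b i.
rewrite h2_normE lecR -[leLHS](ger0_norm (ltW bi)) -sqrtr_sqr ler_wsqrtr//.
apply: le_trans (sqnorm_partial _ i.+1); rewrite big_ord_recr /= eqxx.
by rewrite normc1 expr1n mul1r lerDr sumr_ge0// => k _; rewrite mulr_ge0 ?sqr_ge0.
Qed.

(** The n-th iterate agrees with the n-step shift on monomials, so it inherits the bound [d] of that
    shift instead of the cruder [c ^+ n]. *)
Lemma iter_shift_le (b : weight R) (T : {linear H2 b -> H2 b}) (c d : R) n f :
  0 <= c -> 0 <= d -> (forall i, T (monomial b i) = monomial b (i + 1)%N) ->
  (forall f, `|T f| <= c%:C * `|f|) -> (forall i, b (i + n)%N <= d * b i) ->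
  `|iter n T f| <= d%:C * `|f|.
Proof.
move=> c0 d0 T1 Tc bd; have [S S1 Sd] := shift_operator d0 bd.
have linT : linear (iter n T).
  by elim: n {bd S S1 Sd} => [//|n ih] u g h /=; rewrite ih linearP.
have [T' T'E] := linear_map_of linT.
rewrite -T'E (_ : T' f = S f) ?Sd//.
apply: (@monomial_ext _ _ _ T' S (c ^+ n) d) => // [g|i]; rewrite T'E.
  elim: n {bd S S1 Sd linT T' T'E} => [|n ih]; first by rewrite expr0 mul1r.
  rewrite iterS (le_trans (Tc _))// exprS rmorphM -mulrA ler_wpM2l ?ler0c//.
rewrite S1; elim: n {bd S S1 Sd linT T' T'E} => [|n ih]; first by rewrite addn0.
by rewrite iterS ih T1 -addnA addn1.
Qed.

Theorem intermediate_growth_not_similar :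
  exists (b : weight R) (m : nat) (B : C -> C),
     [/\ intermediate_growth b, finite_blaschke m B
       & exists MB Mz : {linear H2 b -> H2 b},
           [/\ is_multiplication B MB,
               is_multiplication (fun z => z) Mz
             & ~ similar_operators MB (hsum_op m Mz)]].
Proof.
pose b := sqrt_exp; have b0 n : 0 <= b n by rewrite ltW// weight_gt0.
have [MB MB1 MBc] := shift_operator (b0 4%N) (sqrt_exp_submult 4).
have [Mz Mz1 Mzc] := shift_operator (b0 1%N) (sqrt_exp_submult 1).
exists b, 4%N, (fun z => z ^+ 4); split; first exact: sqrt_exp_intermediate.
  exact: finite_blaschke_exp.
exists MB, Mz; split.
- exact: shift_multiplication (b0 4%N) MBc MB1.
- exact: (@shift_multiplication _ _ _ 1 _ (b0 1%N)).
move=> [X [Y [_ /bounded_operatorP[c c0 Yc] XY _ XMB]]].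
pose h := X (monomial b 0).
have XE n : X (monomial b (4 * n)%N) = iter n (hsum_op 4 Mz) h.
  elim: n => [//|n ih]; rewrite iterS -ih -XMB MB1; congr (X (monomial b _)).
  by rewrite mulnS addnC.
have hE n j : iter n (hsum_op 4 Mz) h j = iter n Mz (h j).
  by elim: n => [//|n ih]; rewrite !iterS ffunE ih.
(* [K] is the bound of the inverse [Y] times the sum of the norms of the components of [h], the
   image of the constant 1. *)
pose K : R := c * \sum_j Num.sqrt (sqnorm (h j)).
have bK n : b (4 * n)%N <= K * b n.
  rewrite -lecR (le_trans (monomial_norm_ge _ _))// -[monomial b (4 * n)]XY XE.
  rewrite (le_trans (Yc _))// /K -mulrA rmorphM ler_wpM2l ?ler0c//.
  apply: le_trans (hsum_norm_le _) _.
  rewrite mulr_suml rmorph_sum /=; apply: ler_sum => j _; rewrite hE mulrC rmorphM.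
  exact: (iter_shift_le _ (b0 1%N) (b0 n) Mz1 Mzc (sqrt_exp_submult n)).
(* At [n = N ^ 2] the inequality reads [expR (N + N) <= K * expR N], so [K] would dominate every
   [expR N] and hence every integer. *)
have K1 N : N%:R <= K.
  have := bK (N ^ 2)%N; rewrite /b /= /sqrt_exp_seq.
  have -> : (4 * N ^ 2 = (N + N) ^ 2)%N by rewrite addnn -muln2 expnMn mulnC.
  rewrite !sqrtn_sqr natrD expRD ler_pM2r ?expR_gt0// => /(le_trans _); apply.
  by apply: le_trans (expR_ge1Dx _); rewrite lerDr.
have := K1 (Num.trunc K).+1; rewrite leNgt truncnS_gt//.
Qed.

End Intermediate_growth.

Theorem corollary4p10 (R : realType) :
  (forall (m : nat) (B : R[i] -> R[i]) (b : weight R),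
     finite_blaschke m B -> polynomial_growth b ->
     exists MB Mz : {linear H2 b -> H2 b},
       [/\ is_multiplication B MB,
           is_multiplication (fun z => z) Mz
         & similar_operators MB (hsum_op m Mz)])
  /\
  (exists (b : weight R) (m : nat) (B : R[i] -> R[i]),
     [/\ intermediate_growth b, finite_blaschke m B
       & exists MB Mz : {linear H2 b -> H2 b},
           [/\ is_multiplication B MB,
               is_multiplication (fun z => z) Mz
             & ~ similar_operators MB (hsum_op m Mz)]]).
Proof.
split; last exact: intermediate_growth_not_similar.
by move=> m B b; exact: polynomial_growth_similar.
Qed.
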